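(* Let $k,l$ be fixed integers and let $n\to\infty$. (1) If $l\ge 3$ and $k\ge 2$, then $ex(n,C_{2l},C_{2k})\le (1+o(1))\frac{2^{l-2}(k-1)^l}{2l}n^l$. (2) If $k>l\ge 2$, then $ex(n,C_{2l},C_{2k})\ge (1+o(1))\frac{(k-1)_l}{2l}n^l$. (3) If $l>k\ge 3$, then $ex(n,C_{2l},C_{2k})\ge (1+o(1))\frac{1}{l^l}n^l$.
   Context: $C_k$ denotes the cycle with $k$ vertices. For a graph $H$ and a family of graphs $\mathcal F$ (or a single graph $F$), $ex(n,H,\mathcal F)$ is the maximum number of (not necessarily induced) subgraphs isomorphic to $H$ in an $n$-vertex graph containing no member of $\mathcal F$ as a subgraph. For positive integers $n,l$, $(n)_l=n(n-1)\cdots(n-l+1)$. *)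

(* Defs.v *)
From mathcomp Require Import all_boot all_algebra.
Set Implicit Arguments. Unset Strict Implicit. Unset Printing Implicit Defensive.

Definition simple_graph n (G : {set {set 'I_n}}) : bool :=
  [forall S in G, #|S| == 2].

(* The set of (not necessarily induced) subgraphs of G isomorphic to the
   cycle C_m, each subgraph identified by its edge set
   {{f 0, f 1}, {f 1, f 2}, ..., {f (m-1), f 0}} for an injective f. *)
Definition cycle_copies n m (G : {set {set 'I_n}}) : {set {set {set 'I_n}}} :=
  [set S : {set {set 'I_n}} | (S \subset G) &&
     [exists f : {ffun 'I_m -> 'I_n},
        injectiveb f && (S == [set [set f i; f (ordS i)] | i : 'I_m])]].

Definition num_cycles n m (G : {set {set 'I_n}}) : nat := #|cycle_copies m G|.

Definition ex_cycle (n l k : nat) : nat :=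
  \max_(G : {set {set 'I_n}} | simple_graph G && (num_cycles (2 * k) G == 0))
     num_cycles (2 * l) G.

(* Main.v *)
(* Upper bound. Let f(a,b) be the codegree. In a C_2k-free graph, greedy paths
   give: the pairs (a,b) with f(a,b) >= k ("fat" pairs) satisfy
   sum_b f(a,b) = O(deg a) for every a. Hence, for every a, sum_b f(a,b) is at
   most (k-1) n + O(deg a), the sum of the squared degrees is O(n^2), there are
   o(n^2) edges and boundedly many vertices of degree >= n/M. The closed walks
   a u b v with both ab and uv fat are also controlled by the number of edges, so
   sum_(a,b) f(a,b)^2 <= 2 (k-1)^2 n^2 + o(n^2). A C_2l alternates between even
   and odd positions. If one of the two classes avoids the vertices of degree
   >= n/M, then each of its 2l labellings with that class in even position is a
   closed walk weighted by f, and there are at most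
   ((k-1+o(1)) n)^(l-2) * 2 (k-1)^2 n^2 of these; here 2 <= 2^(l-2) since l >= 3.
   If both classes meet the vertices of large degree, there are only O(n^(l-1))
   possibilities.

   Lower bounds. For l < k take K_(k-1,n-k+1); for l > k take a cyclic chain of
   l hub vertices, with n/l common neighbours for any two consecutive ones. *)
Require Import Defs.
From mathcomp Require Import all_boot all_order all_algebra.
From mathcomp Require Import zify ring lra.
Set Implicit Arguments. Unset Strict Implicit. Unset Printing Implicit Defensive.

(** * Codegrees in graphs without C_2k *)

Section Graphs.
Variables (T : finType) (e : rel T).
Hypothesis e_sym : symmetric e.

Definition nbrs (x : T) : {set T} := [set y | e x y].
Definition codeg (x y : T) : nat := #|nbrs x :&: nbrs y|.

Lemma in_nbrs x y : (y \in nbrs x) = e x y.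
Proof. by rewrite inE. Qed.

Lemma card_setIsum (A B : {set T}) : #|A :&: B| = \sum_(x in A) (x \in B).
Proof.
rewrite -sum1_card big_mkcond [RHS]big_mkcond /=; apply: eq_bigr => x _.
by rewrite inE; case: (x \in A); case: (x \in B).
Qed.

Lemma sum_nbrsC (X Y : {set T}) :
  \sum_(x in X) #|nbrs x :&: Y| = \sum_(y in Y) #|nbrs y :&: X|.
Proof.
under eq_bigr => x _ do rewrite setIC card_setIsum.
rewrite exchange_big /=; apply: eq_bigr => y _.
rewrite setIC card_setIsum; apply: eq_bigr => x _.
by rewrite !in_nbrs e_sym.
Qed.

Lemma sum_codeg a (Y : {set T}) :
  \sum_(b in Y) codeg a b = \sum_(x in nbrs a) #|nbrs x :&: Y|.
Proof. by rewrite sum_nbrsC; apply: eq_bigr => b _; rewrite /codeg setIC. Qed.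

(** Deleting from one side a vertex of degree below [D] loses fewer than [D] edges while the right
    bound drops by [D], so the density survives every deletion and the process stops at a nonempty
    core. *)
Lemma dense_core D (X Y : {set T}) :
  D * (#|X| + #|Y|) < \sum_(x in X) #|nbrs x :&: Y| ->
  exists X1 Y1 : {set T}, [/\ X1 \subset X, Y1 \subset Y, X1 != set0,
    {in X1, forall x, D <= #|nbrs x :&: Y1|} &
    {in Y1, forall y, D <= #|nbrs y :&: X1|}].
Proof.
move: {2}(_ + _) (leqnn (#|X| + #|Y|)) => m; elim: m X Y => [|m IH] X Y.
  rewrite leqn0 addn_eq0 !cards_eq0 => /andP[/eqP-> /eqP->].
  by rewrite big_set0.
move=> le_m dense.
case: (pickP [pred x in X | #|nbrs x :&: Y| < D]) => [x /andP[/= xX ltD]|allX].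
  have cX : #|X| = (#|X :\ x|).+1 by rewrite (cardsD1 x X) xX.
  have [||X1 [Y1 [sX sY n0 hX hY]]] := IH (X :\ x) Y.
  - by move: le_m; rewrite cX; lia.
  - move: dense; rewrite (bigD1 x) //= (eq_bigl (fun z => z \in X :\ x)) => [|z].
      by rewrite cX addSn mulnS; lia.
    by rewrite !inE andbC.
  by exists X1, Y1; split=> //; apply: subset_trans sX (subsetDl _ _).
case: (pickP [pred y in Y | #|nbrs y :&: X| < D]) => [y /andP[/= yY ltD]|allY].
  have cY : #|Y| = (#|Y :\ y|).+1 by rewrite (cardsD1 y Y) yY.
  have [||X1 [Y1 [sX sY n0 hX hY]]] := IH X (Y :\ y).
  - by move: le_m; rewrite cY; lia.
  - move: dense; rewrite sum_nbrsC [X in _ -> _ < X]sum_nbrsC (bigD1 y) //= (eq_bigl (fun z => z \in Y :\ y)) => [|z].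
      by rewrite cY addnS mulnS; lia.
    by rewrite !inE andbC.
  by exists X1, Y1; split=> //; apply: subset_trans sY (subsetDl _ _).
exists X, Y; split=> //.
- by apply/eqP => X0; move: dense; rewrite X0 big_set0.
- by move=> x xX; move/(_ x)/negbT: allX; rewrite /= xX /= -leqNgt.
- by move=> y yY; move/(_ y)/negbT: allY; rewrite /= yY /= -leqNgt.
Qed.

(* Deleting a vertex of X together with all its neighbours keeps the degrees
   of the surviving vertices of Y intact. *)
Lemma one_sided_core D m (X Y : {set T}) :
  0 < m -> {in Y, forall y, m <= #|nbrs y :&: X|} -> D * #|X| < #|Y| ->
  exists X1 Y1 : {set T}, [/\ X1 \subset X, Y1 \subset Y, X1 != set0,
    {in X1, forall x, D <= #|nbrs x :&: Y1|} &
    {in Y1, forall y, m <= #|nbrs y :&: X1|}].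
Proof.
move=> m0; move: {2}#|X| (leqnn #|X|) => c; elim: c X Y => [|c IH] X Y.
  rewrite leqn0 cards_eq0 => /eqP-> hY; rewrite cards0 muln0 => /card_gt0P[y yY].
  by move: (hY y yY); rewrite setI0 cards0 leqNgt m0.
move=> le_c hY big.
case: (pickP [pred x in X | #|nbrs x :&: Y| < D]) => [x /andP[/= xX ltD]|allX].
  have cX : #|X| = (#|X :\ x|).+1 by rewrite (cardsD1 x X) xX.
  have [|||X1 [Y1 [sX sY n0 hX hY1]]] := IH (X :\ x) (Y :\: nbrs x).
  - by move: le_c; rewrite cX; lia.
  - move=> y; rewrite inE in_nbrs => /andP[nxy yY].
    apply: leq_trans (hY y yY) (subset_leq_card _).
    apply/subsetP => z; rewrite !inE => /andP[yz ->]; rewrite yz !andbT.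
    by apply: contraNneq nxy => <-; rewrite e_sym.
  - by rewrite [in X in _ < X]cardsD [Y :&: _]setIC; move: big; rewrite cX mulnS; lia.
  exists X1, Y1; split=> //; first exact: subset_trans sX (subsetDl _ _).
  exact: subset_trans sY (subsetDl _ _).
exists X, Y; split=> //.
  apply/eqP => X0; move: big; rewrite X0 cards0 muln0 => /card_gt0P[y yY].
  by move: (hY y yY); rewrite X0 setI0 cards0 leqNgt m0.
by move=> x xX; move/(_ x)/negbT: allX; rewrite /= xX /= -leqNgt.
Qed.

Lemma card_avoid (A : {set T}) (s : seq T) :
  count [in A] s < #|A| -> exists2 x, x \in A & x \notin s.
Proof.
move=> lt.
case: (pickP [pred x in A | x \notin s]) => [x /andP[? ?]|all_in]; first by exists x.
suff: #|A| <= count [in A] s by rewrite leqNgt lt.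
rewrite -size_filter; apply: leq_trans (card_size _); apply: subset_leq_card.
apply/subsetP => x xA; rewrite mem_filter xA /=.
by move/(_ x)/negbT: all_in; rewrite /= xA /= negbK.
Qed.

(** The path zigzags between [X] and [Y], which may overlap: [c = 0] expresses disjointness, [c = 1]
    imposes nothing. Only path vertices inside [X] obstruct a step from [Y] back to [X], whence the
    demand [c.+1 * h] on that side. *)
Lemma greedy_path c h (X Y : {set T}) :
  X != set0 -> {in Y, forall y, (y \in X) <= c} ->
  {in X, forall x, 2 * h <= #|nbrs x :&: Y|} ->
  {in Y, forall y, c.+1 * h <= #|nbrs y :&: X|} ->
  forall j, j < h -> exists x p, [/\ x \in X, path e x p, uniq (x :: p),
    last x p \in X & [/\ size p = 2 * j, {subset x :: p <= X :|: Y} &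
    count [in X] (x :: p) <= j.+1 + c * j]].
Proof.
case/set0Pn=> x xX cY hX hY; elim=> [|j IH] lt_jh.
  exists x, [::]; split=> //; split; rewrite //= ?xX ?muln0 //.
  by move=> z; rewrite !inE => /eqP->; rewrite xX.
have [x' [p [x'X pp up lX [szp sub cnt]]]] := IH (ltnW lt_jh).
have [|y /setIP[ey yY] ynp] := @card_avoid (nbrs (last x' p) :&: Y) (x' :: p).
  apply: leq_ltn_trans (count_size _ _) (leq_trans _ (hX _ lX)).
  by rewrite /= szp; clear -lt_jh; lia.
have [|z /setIP[ez zX] znp] := @card_avoid (nbrs y :&: X) (rcons (x' :: p) y).
  apply: leq_trans (hY _ yY).
  apply: (@leq_ltn_trans (count [in X] (rcons (x' :: p) y))).
    by apply: sub_count => t; rewrite inE => /andP[].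
  have : c * j.+1 <= c * h by rewrite leq_mul2l ltnW ?orbT.
  have := cY y yY; move: cnt; rewrite -cats1 count_cat /= addn0 mulSn !mulnS.
  by clear -lt_jh; case: (y \in X) => /=; lia.
have E : x' :: rcons (rcons p y) z = rcons (rcons (x' :: p) y) z by [].
exists x', (rcons (rcons p y) z); split; rewrite ?E //.
- by rewrite !rcons_path pp /= last_rcons -!in_nbrs ey ez.
- by rewrite !rcons_uniq znp ynp.
- by rewrite last_rcons.
split; first by rewrite !size_rcons szp; clear; lia.
  move=> t; rewrite mem_rcons in_cons mem_rcons in_cons => /or3P[/eqP->|/eqP->|].
  - by rewrite inE zX.
  - by rewrite inE yY orbT.
  - by move=> t_in; apply: sub.
rewrite -!cats1 !count_cat /= zX !addn0; have := cY y yY.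
by move: cnt; rewrite /= mulnS; clear; case: (y \in X) => /=; lia.
Qed.

(** * Excluding cores in graphs without C_2k *)

Hypothesis e_irr : irreflexive e.
Variable k : nat.
Hypothesis k2 : 2 <= k.
Hypothesis no_cycle : forall s, size s = 2 * k -> uniq s -> ~~ cycle e s.

(** A greedy path on 2k-1 vertices has both ends adjacent to [a], which closes it into a forbidden
    cycle. *)
Lemma no_core_at_vertex c a (X Y : {set T}) :
  X \subset nbrs a -> a \notin Y -> X != set0 ->
  {in Y, forall y, (y \in X) <= c} ->
  {in X, forall x, 2 * k <= #|nbrs x :&: Y|} ->
  {in Y, forall y, c.+1 * k <= #|nbrs y :&: X|} -> False.
Proof.
move=> sX aY X0 cY hX hY.
have [|x [p [xX pp up lX [szp sub _]]]] := greedy_path X0 cY hX hY (j := k.-1).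
  by rewrite prednK // ltnW.
apply: (negP (@no_cycle (a :: x :: p) _ _)).
- by rewrite /= szp; clear -k2; lia.
- rewrite cons_uniq up andbT; apply/negP => /sub; rewrite inE (negPf aY) orbF.
  by move/(subsetP sX); rewrite in_nbrs e_irr.
- rewrite /= -[e a x]in_nbrs (subsetP sX) //= rcons_path pp e_sym -in_nbrs.
  exact: (subsetP sX).
Qed.

(** A path on 2k-2 vertices from [X] to [Y] is closed by [u] and [a] into a cycle of length 2k. *)
Lemma no_core_at_edge a u (X Y : {set T}) :
  e a u -> X \subset nbrs a :\ u -> Y \subset nbrs u :\ a -> X != set0 ->
  {in X, forall x, 2 * k <= #|nbrs x :&: Y|} ->
  {in Y, forall y, 2 * k <= #|nbrs y :&: X|} -> False.
Proof.
move=> eau sX sY X0 hX hY.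
have [||x [p [xX pp up lX [szp sub _]]]] :=
    greedy_path X0 _ hX hY (c := 1) (j := k.-2).
- by move=> y _; case: (y \in X).
- by lia.
(* The greedy path ends in [X]; one more vertex moves its end to [Y], next to [u]. *)
have [|y /setIP[ey yY] ynp] := @card_avoid (nbrs (last x p) :&: Y) (x :: p).
  apply: leq_ltn_trans (count_size _ _) (leq_trans _ (hX _ lX)).
  by rewrite /= szp; clear -k2; lia.
have not_in z : z \in [:: a; u] -> z \notin rcons (x :: p) y.
  have aX : a \notin X by apply/negP => /(subsetP sX); rewrite !inE e_irr andbF.
  have uX : u \notin X by apply/negP => /(subsetP sX); rewrite !inE eqxx.
  have aY : a \notin Y by apply/negP => /(subsetP sY); rewrite !inE eqxx.
  have uY : u \notin Y by apply/negP => /(subsetP sY); rewrite !inE e_irr andbF.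
  move=> z_in; have zX : z \notin X by move: z_in; rewrite !inE => /orP[] /eqP->.
  have zY : z \notin Y by move: z_in; rewrite !inE => /orP[] /eqP->.
  rewrite mem_rcons in_cons negb_or; apply/andP; split.
    by apply: contraNneq zY => ->.
  by apply/negP => /sub; rewrite inE (negPf zX) (negPf zY).
apply: (negP (@no_cycle (a :: rcons (rcons (x :: p) y) u) _ _)).
- by rewrite /= !size_rcons szp; clear -k2; lia.
- rewrite cons_uniq !rcons_uniq up ynp mem_rcons in_cons negb_or.
  rewrite !not_in ?inE ?eqxx ?orbT //= !andbT.
  by apply/eqP => au; move: eau; rewrite au e_irr.
- move: ey; rewrite in_nbrs => ey; rewrite /= !rcons_path pp !last_rcons /= ey (e_sym u) eau !andbT.
  rewrite (e_sym y).
  have := subsetP sX x xX; have := subsetP sY y yY.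
  by rewrite !inE => /andP[_ ->] /andP[_ ->].
Qed.

(** A larger sum would produce an excluded core, taken with [c = 1] because [Y] may meet [X]. *)
Lemma edges_at_vertex a (X Y : {set T}) : X \subset nbrs a -> a \notin Y ->
  \sum_(x in X) #|nbrs x :&: Y| <= 2 * k * (#|X| + #|Y|).
Proof.
move=> sX aY; rewrite leqNgt; apply/negP => /dense_core[X1 [Y1 [sX1 sY1 n0 hX hY]]].
apply: (@no_core_at_vertex 1 a X1 Y1) => //; first exact: subset_trans sX1 sX.
  by apply: contra aY; apply: subsetP.
by move=> y _; case: (y \in X1).
Qed.

Lemma edges_at_edge a u (X Y : {set T}) :
  e a u -> X \subset nbrs a :\ u -> Y \subset nbrs u :\ a ->
  \sum_(x in X) #|nbrs x :&: Y| <= 2 * k * (#|X| + #|Y|).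
Proof.
move=> eau sX sY; rewrite leqNgt; apply/negP => /dense_core[X1 [Y1 [sX1 sY1 n0 hX hY]]].
by apply: (@no_core_at_edge a u X1 Y1) => //; apply: subset_trans; eassumption.
Qed.

(** * Fat pairs and row sums of codegrees *)

Definition fat a b := (a != b) && (k <= codeg a b).

Lemma codegC a b : codeg a b = codeg b a. Proof. by rewrite /codeg setIC. Qed.

(** The factor [2k] of [edges_at_vertex] times [2k + 2], which bounds the neighbourhood of [a]
    together with the fat partners of [a], in units of the degree. *)
Definition fat_const := 4 * k * k.+1.

(** This set is disjoint from [nbrs a], so [c = 0] is allowed and the degree [k] provided by fatness
    is enough. The one-sided core keeps that degree unchanged. *)
Lemma card_fat_outside a :
  #|[set b | fat a b && (b \notin nbrs a)]| <= 2 * k * #|nbrs a|.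
Proof.
set Y := [set b | _]; rewrite leqNgt; apply/negP => big.
have hY : {in Y, forall y, k <= #|nbrs y :&: nbrs a|}.
  by move=> y; rewrite inE => /andP[/andP[_ h] _]; rewrite -[#|_|]/(codeg y a) codegC.
have [|X1 [Y1 [sX1 sY1 n0 hX1 hY1]]] := one_sided_core _ hY big; first by lia.
apply: (@no_core_at_vertex 0 a X1 Y1) => //.
- by apply/negP => /(subsetP sY1); rewrite inE /fat eqxx.
- move=> y /(subsetP sY1); rewrite inE => /andP[_ nya].
  by rewrite leqn0 eqb0; apply: contra nya; apply: subsetP.
- by move=> y /hY1; rewrite mul1n.
Qed.

Lemma sum_fat a : \sum_(b | fat a b) codeg a b <= fat_const * #|nbrs a|.
Proof.
set Y := [set b | fat a b].
have -> : \sum_(b | fat a b) codeg a b = \sum_(b in Y) codeg a b.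
  by apply: eq_bigl => b; rewrite inE.
rewrite sum_codeg; apply: leq_trans (@edges_at_vertex a _ _ _ _) _ => //.
  by rewrite inE /fat eqxx.
have : #|Y| <= 2 * k * #|nbrs a| + #|nbrs a|.
  apply: leq_trans (leq_add (card_fat_outside a) (leqnn _)).
  apply: leq_trans (leq_card_setU _ _); apply: subset_leq_card.
  by apply/subsetP => b; rewrite !inE => ->; case: (e a b).
by rewrite /fat_const; nia.
Qed.

(** Thin partners contribute at most [k.-1] each; the fat ones are absorbed by [sum_fat]. *)
Lemma codeg_row a :
  \sum_(b | b != a) codeg a b <= k.-1 * #|T| + fat_const * #|nbrs a|.
Proof.
rewrite (bigID (fat a)) /= addnC; apply: leq_add; last first.
  apply: leq_trans (sum_fat a); rewrite [X in X <= _]big_mkcond [X in _ <= X]big_mkcond.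
  by apply: leq_sum => b _; rewrite /fat (eq_sym b); case: (a == b); case: (k <= _).
apply: (@leq_trans (\sum_(b : T) k.-1)); last by rewrite sum_nat_const mulnC.
rewrite big_mkcond; apply: leq_sum => b _; rewrite /fat (eq_sym b).
by case: (a == b) => //=; case: (leqP k (codeg a b)) => //= lt; clear -lt; lia.
Qed.

Lemma sum_codeg_all a : \sum_b codeg a b = \sum_(x in nbrs a) #|nbrs x|.
Proof.
have -> : \sum_b codeg a b = \sum_(b in [set: T]) codeg a b.
  by apply: eq_bigl => b; rewrite inE.
by rewrite sum_codeg; apply: eq_bigr => x _; rewrite setIT.
Qed.

(** * Sums of degrees and of squared degrees *)

Definition sum_deg := \sum_a #|nbrs a|.

Lemma sum_deg_le : sum_deg <= #|T| ^ 2.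
Proof.
by rewrite -mulnn -[X in _ <= X]sum_nat_const; apply: leq_sum => a _; apply: max_card.
Qed.

(** Walks of length two are counted by their midpoint and by their ends. The diagonal terms
    [codeg a a] are degrees, which raises [fat_const] to [fat_const.+1]. *)
Lemma sum_sqr_deg : \sum_a #|nbrs a| ^ 2 <= (k + fat_const) * #|T| ^ 2.
Proof.
have -> : \sum_a #|nbrs a| ^ 2 = \sum_a \sum_b codeg a b.
  under [RHS]eq_bigr => a _ do rewrite sum_codeg_all big_mkcond /=.
  rewrite exchange_big /=; apply: eq_bigr => x _.
  rewrite -mulnn -sum_nat_const [LHS]big_mkcond /=.
  by apply: eq_bigr => a _; rewrite !in_nbrs e_sym.
have row a : \sum_b codeg a b <= k.-1 * #|T| + fat_const.+1 * #|nbrs a|.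
  rewrite (bigD1 a) //= {1}/codeg setIid mulSn addnCA leq_add2l; exact: codeg_row.
apply: (@leq_trans (\sum_a (k.-1 * #|T| + fat_const.+1 * #|nbrs a|))).
  by apply: leq_sum => a _; apply: row.
rewrite big_split /= sum_nat_const -big_distrr /= -/sum_deg.
apply: (@leq_trans (k.-1 * #|T| ^ 2 + fat_const.+1 * #|T| ^ 2)).
  apply: leq_add; first by rewrite mulnCA mulnn.
  by rewrite leq_mul2l sum_deg_le orbT.
by rewrite -mulnDl leq_mul2r; apply/orP; right; clear -k2; lia.
Qed.

(** Sum of [2 M d <= d^2 + M^2] over the degrees [d]. With [M] large it makes the number of edges a
    small fraction of the squared order. *)
Lemma sum_deg_small M : 2 * M * sum_deg <= (k + fat_const) * #|T| ^ 2 + M ^ 2 * #|T|.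
Proof.
apply: leq_trans (leq_add sum_sqr_deg (leqnn _)).
rewrite /sum_deg big_distrr /= [M ^ 2 * _]mulnC -sum_nat_const -big_split /=.
by apply: leq_sum => a _; rewrite -mulnA [M * _]mulnC; apply: leq_of_leqif (nat_Cauchy _ _).
Qed.

(** Markov's inequality for the squared degrees. *)
Lemma card_big_deg M :
  #|T| ^ 2 * #|[set a | #|T| <= M * #|nbrs a|]| <= M ^ 2 * ((k + fat_const) * #|T| ^ 2).
Proof.
apply: (@leq_trans (M ^ 2 * \sum_a #|nbrs a| ^ 2)); last first.
  by rewrite leq_mul2l sum_sqr_deg orbT.
rewrite mulnC -sum_nat_const big_distrr /= [X in X <= _]big_mkcond /=.
apply: leq_sum => a _; rewrite inE; case: ifP => // h.
by rewrite -expnMn leq_exp2r.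
Qed.

(** * Closed walks of length four and squared codegrees *)

Definition walk4 a u b v := [&& e a u, e u b, e b v & e v a].

Lemma codeg_sqr a b : codeg a b ^ 2 = \sum_u \sum_v walk4 a u b v.
Proof.
have E x y : codeg x y = \sum_u (e x u && e u y).
  rewrite /codeg card_setIsum big_mkcond; apply: eq_bigr => u _.
  by rewrite !in_nbrs (e_sym y); case: (e x u); case: (e u y).
rewrite -mulnn {1}E big_distrl /=; apply: eq_bigr => u _.
rewrite codegC E big_distrr /=; apply: eq_bigr => v _.
by rewrite /walk4; case: (e a u); case: (e u b); case: (e b v); case: (e v a).
Qed.

(** Lets the diagonals [ab] and [uv] of a closed 4-walk trade places. *)
Lemma quad_exchange (H : T -> T -> T -> T -> nat) :
  \sum_a \sum_b \sum_u \sum_v H a b u v = \sum_u \sum_v \sum_a \sum_b H a b u v.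
Proof.
under eq_bigr => a _.
  rewrite exchange_big /=; under eq_bigr => u _ do rewrite exchange_big /=.
  over.
rewrite exchange_big /=; apply: eq_bigr => u _.
by rewrite exchange_big.
Qed.

Lemma thin_walks :
  \sum_a \sum_b \sum_u \sum_v ((a != b) && ~~ fat a b && walk4 a u b v)
    <= (k.-1 * #|T|) ^ 2.
Proof.
rewrite expnMn -mulnn mulnC -mulnA -[X in _ <= X]sum_nat_const; apply: leq_sum => a _.
rewrite -[X in _ <= X]sum_nat_const; apply: leq_sum => b _.
case: (boolP ((a != b) && ~~ fat a b)) => [|_]; last first.
  by rewrite big1 // => u _; rewrite big1.
rewrite -codeg_sqr /fat => /andP[-> /=]; rewrite -ltnNge => lt.
by rewrite leq_exp2r //; lia.
Qed.

(** With [u = v] the walk degenerates to a path [a u b] over a fat pair, counted by [sum_fat]. *)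
Lemma fat_diag :
  \sum_a \sum_b \sum_u \sum_v (fat a b && (u == v) && walk4 a u b v) <= fat_const * sum_deg.
Proof.
rewrite /sum_deg big_distrr /=; apply: leq_sum => a _.
apply: leq_trans (sum_fat a); rewrite [X in _ <= X]big_mkcond /=.
apply: leq_sum => b _; case: (fat a b); last by rewrite big1 // => u _; rewrite big1.
rewrite /codeg card_setIsum [X in _ <= X]big_mkcond /=; apply: leq_sum => u _.
rewrite (bigD1 u) //= big1 => [|v /negPf]; last by rewrite eq_sym => ->.
by rewrite eqxx addn0 /walk4 !in_nbrs (e_sym u b) (e_sym u a); case: (e a u); case: (e b u).
Qed.

(** For a fixed edge [au], the vertex [b] runs through neighbours of [u] and [v] through neighbours
    of [a], and [bv] is an edge between these sets; [edges_at_edge] bounds the number of such edges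
    by the sizes of the sets. *)
Lemma fat_fat_walks :
  \sum_a \sum_b \sum_u \sum_v (fat a b && fat u v && walk4 a u b v)
    <= 4 * k * fat_const * sum_deg.
Proof.
under eq_bigr => a _ do rewrite exchange_big /=.
have bound a u : \sum_b \sum_v (fat a b && fat u v && walk4 a u b v) <=
  if e a u then 2 * k * (\sum_v (fat u v && e v a) + \sum_b (fat a b && e u b)) else 0.
  case: ifP => eau; last by rewrite big1 // => b _; rewrite big1 // => v _; rewrite /walk4 eau andbF.
  pose X := [set v | fat u v && e v a]; pose Y := [set b | fat a b && e u b].
  have sX : X \subset nbrs a :\ u.
    by apply/subsetP => v; rewrite !inE e_sym => /andP[/andP[uv _] ->]; rewrite eq_sym uv.
  have sY : Y \subset nbrs u :\ a.
    by apply/subsetP => v; rewrite !inE => /andP[/andP[uv _] ->]; rewrite eq_sym uv.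
  have cE (P : pred T) : \sum_v P v = #|[set v | P v]|.
    rewrite -sum1_card [RHS]big_mkcond; apply: eq_bigr => v _.
    by rewrite inE; case: (P v).
  rewrite !cE; apply: leq_trans (edges_at_edge eau sX sY).
  rewrite exchange_big [X in _ <= X]big_mkcond /=; apply: leq_sum => v _.
  rewrite inE; case: (fat u v); case eva: (e v a);
    try by rewrite big1 // => b _; rewrite /walk4 eva ?andbF.
  rewrite setIC card_setIsum [X in _ <= X]big_mkcond /=; apply: leq_sum => b _.
  rewrite !inE /walk4 eau eva (e_sym v).
  by case: (fat a b); case: (e u b); case: (e b v).
apply: (@leq_trans (\sum_a \sum_u if e a u then
    2 * k * (\sum_v (fat u v && e v a) + \sum_b (fat a b && e u b)) else 0)).
  by apply: leq_sum => a _; apply: leq_sum => u _; apply: bound.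
(* Summed over the edges [au], the set sizes become fat codegrees again. *)
have half : \sum_a \sum_u (if e a u then \sum_b (fat a b && e u b) else 0) <= fat_const * sum_deg.
  rewrite /sum_deg big_distrr /=; apply: leq_sum => a _.
  apply: leq_trans (sum_fat a); rewrite [X in _ <= X]big_mkcond /=.
  rewrite -[X in X <= _]big_mkcond exchange_big /=; apply: leq_sum => b _.
  case: (fat a b); last by rewrite big1.
  rewrite /codeg card_setIsum [X in _ <= X]big_mkcond [X in X <= _]big_mkcond /=.
  by apply: leq_sum => u _; rewrite !in_nbrs (e_sym b).
have half' : \sum_a \sum_u (if e a u then \sum_v (fat u v && e v a) else 0) <= fat_const * sum_deg.
  rewrite exchange_big /=; apply: leq_trans half; apply: leq_sum => a _.
  apply: leq_sum => u _; rewrite e_sym; case: ifP => // _.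
  by apply: leq_sum => v _; rewrite e_sym.
apply: (@leq_trans (2 * k * (fat_const * sum_deg + fat_const * sum_deg))); last by nia.
apply: leq_trans (leq_mul (leqnn _) (leq_add half' half)).
rewrite -big_split big_distrr /=; apply: leq_sum => a _.
rewrite -big_split big_distrr /=; apply: leq_sum => u _.
by case: ifP => //; rewrite addn0 muln0.
Qed.

(* A 4-cycle a u b v has a thin diagonal ab, a thin diagonal uv, or both
   diagonals fat (or is degenerate); the last kinds are negligible. *)
Lemma sum_codeg_sqr :
  \sum_a \sum_(b | b != a) codeg a b ^ 2
    <= 2 * (k.-1 * #|T|) ^ 2 + (4 * k).+1 * fat_const * sum_deg.
Proof.
have -> : 2 * (k.-1 * #|T|) ^ 2 + (4 * k).+1 * fat_const * sum_deg =
  (k.-1 * #|T|) ^ 2 + (k.-1 * #|T|) ^ 2 + (fat_const * sum_deg + 4 * k * fat_const * sum_deg) by lia.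
have thin' : \sum_a \sum_b \sum_u \sum_v ((u != v) && ~~ fat u v && walk4 a u b v)
    <= (k.-1 * #|T|) ^ 2.
  apply: leq_trans thin_walks; rewrite quad_exchange.
  apply: leq_sum => u _; apply: leq_sum => v _; apply: leq_sum => a _; apply: leq_sum => b _.
  rewrite /walk4 (e_sym v a) (e_sym b v) (e_sym u b) (e_sym a u).
  by case: (e u a); case: (e b u); case: (e v b); case: (e a v); rewrite ?andbF.
apply: leq_trans (leq_add (leq_add thin_walks thin') (leq_add fat_diag fat_fat_walks)).
rewrite -!big_split /=; apply: leq_sum => a _; rewrite big_mkcond -!big_split /=.
apply: leq_sum => b _; rewrite eq_sym; case: ifP => // _; rewrite codeg_sqr.
rewrite -!big_split; apply: leq_sum => u _; rewrite -!big_split; apply: leq_sum => v _ /=.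
case: (walk4 _ _ _ _) => //.
by case: (fat a b) => //=; case: (u == v) => //=; case: (fat u v).
Qed.

End Graphs.

(** * Counting closed walks *)

Section Walks.
Variables (T : finType) (C : nat -> T -> T -> T -> bool).

(** [C i x w y] allows [w] as midpoint of the [i]-th double step, from [x] to [y]. A closed walk of
    length 2l is thus read as [l] matrix factors. *)
Definition step i x y : nat := #|[set w | C i x w y]|.

(* The entry (x, z) of the product of the m matrices step i, step (i+1), ... *)
Fixpoint walks i m x z : nat :=
  if m is m'.+1 then \sum_y step i x y * walks i.+1 m' y z else x == z.

(** Lists each walk by its vertices after the start, so that labellings can be injected into
    walks. *)
Fixpoint walk_list i m x z : seq (seq T) :=
  if m is m'.+1 then
    flatten [seq [seq p.1 :: y :: p.2 | p <- [seq (w, s) | w <- enum [set w | C i x w y],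
                                           s <- walk_list i.+1 m' y z]] | y <- enum T]
  else nseq (x == z) [::].

Lemma size_walk_list i m x z : size (walk_list i m x z) = walks i m x z.
Proof.
elim: m i x => [|m IH] i x /=; first by rewrite size_nseq.
rewrite size_flatten /shape -map_comp sumnE big_map enumT; apply: eq_bigr => y _ /=.
by rewrite size_map size_allpairs IH -cardE.
Qed.

Lemma mem_walk_list (h : nat -> T) i m :
  (forall j, j < m -> C (i + j) (h (2 * j)) (h (2 * j).+1) (h (2 * j).+2)) ->
  [seq h j | j <- iota 1 (2 * m)] \in walk_list i m (h 0) (h (2 * m)).
Proof.
elim: m i h => [|m IH] i h hC; first by rewrite muln0 /= eqxx.
rewrite mulnS /=; apply/flattenP.
exists [seq p.1 :: h 2 :: p.2 | p <- [seq (w, s) | w <- enum [set w | C i (h 0) w (h 2)],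
          s <- walk_list i.+1 m (h 2) (h (2 * m).+2)]].
  by apply/mapP; exists (h 2) => //; rewrite mem_enum.
apply/mapP; exists (h 1, [seq h j | j <- iota 3 (2 * m)]) => //.
apply/allpairsP; exists (h 1, [seq h j | j <- iota 3 (2 * m)]); split=> //=.
  by rewrite mem_enum inE; have := hC 0 isT; rewrite addn0.
rewrite -[3]/(2 + 1) iotaDl -map_comp; apply: (IH i.+1 (fun j => h j.+2)).
by move=> j lt_jm; have := hC j.+1 lt_jm; rewrite addnS mulnS.
Qed.

(** Indexing by all naturals makes [j] and [j.+1] consecutive positions even where the cycle wraps
    around. *)
Definition periodic (A : Type) m (m0 : 0 < m) (f : 'I_m -> A) j := f (Ordinal (ltn_pmod j m0)).

(** The values at positions 0 to 2l form a closed walk, and this list determines the labelling. *)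
Lemma card_closed_walks l (l0 : 0 < 2 * l) (L : {set {ffun 'I_(2 * l) -> T}}) :
  (forall f j, f \in L -> j < l -> let g := periodic l0 f in
     C j (g (2 * j)) (g (2 * j).+1) (g (2 * j).+2)) ->
  #|L| <= \sum_u walks 0 l u u.
Proof.
move=> hL; pose code (f : {ffun 'I_(2 * l) -> T}) := [seq periodic l0 f j | j <- iota 0 (2 * l).+1].
have code_inj : injective code.
  move=> f f' eq_ff'; apply/ffunP => i.
  have := congr1 (fun s => nth (f i) s i) eq_ff'.
  have ltS : i < (2 * l).+1 by apply: leq_trans (ltn_ord i) _.
  rewrite !(nth_map 0) ?size_iota // nth_iota // add0n /periodic.
  by congr (_ = _); apply: congr1; apply: val_inj; rewrite /= modn_small.
have -> : \sum_u walks 0 l u u =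
    size (flatten [seq [seq u :: s | s <- walk_list 0 l u u] | u <- enum T]).
  rewrite size_flatten /shape -map_comp sumnE big_map enumT; apply: eq_bigr => u _.
  by rewrite /= size_map size_walk_list.
rewrite cardE -(size_map code); apply: uniq_leq_size.
  by rewrite map_inj_uniq // enum_uniq.
move=> _ /mapP[f fL ->]; rewrite mem_enum in fL.
set g := periodic l0 f; have g0 : g (2 * l) = g 0.
  by congr (f _); apply: val_inj; rewrite /= modnn mod0n.
apply/flattenP; exists [seq g 0 :: s | s <- walk_list 0 l (g 0) (g 0)].
  by apply/mapP; exists (g 0); rewrite ?mem_enum.
apply/mapP; exists [seq g j | j <- iota 1 (2 * l)] => //.
by rewrite -{2}g0; apply: mem_walk_list => j; apply: hL.
Qed.

Variable K : nat.
Hypothesis rowK : forall i x, \sum_y step i x y <= K.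
Hypothesis colK : forall i y, \sum_x step i x y <= K.

Lemma walks_row i m x : \sum_z walks i m x z <= K ^ m.
Proof.
elim: m i x => [|m IH] i x.
  by rewrite /= (bigD1 x) //= eqxx big1 // => z /negPf; rewrite eq_sym => ->.
rewrite exchange_big /= expnS; apply: leq_trans (leq_mul (rowK i x) (leqnn _)).
rewrite big_distrl /=; apply: leq_sum => y _; rewrite -big_distrr /=.
by rewrite leq_mul2l IH orbT.
Qed.

Lemma walks_col i m z : \sum_x walks i m x z <= K ^ m.
Proof.
elim: m i => [|m IH] i.
  by rewrite /= (bigD1 z) //= eqxx big1 // => x /negPf ->.
rewrite exchange_big /= expnS; apply: leq_trans (leq_mul (leqnn _) (IH i.+1)).
rewrite big_distrr /=; apply: leq_sum => y _; rewrite -big_distrl /=.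
by rewrite leq_mul2r colK orbT.
Qed.

(** The factors before place [p] are bounded by row sums, the factor at [p] entrywise, those after
    it by column sums. *)
Lemma walks_entry b p i m x z : p < m -> (forall x y, step (i + p) x y <= b) ->
  walks i m x z <= b * K ^ m.-1.
Proof.
elim: p i m x => [|p IH] i [|m] x //= lt_pm hb.
  apply: leq_trans (leq_mul (leqnn _) (walks_col i.+1 m z)).
  rewrite big_distrr; apply: leq_sum => y _ /=.
  by rewrite leq_mul2r -[X in step X]addn0 hb orbT.
have {}lt_pm : p < m by [].
case: m lt_pm => // m lt_pm; rewrite expnS mulnCA.
apply: leq_trans (leq_mul (rowK i x) (leqnn _)).
rewrite big_distrl; apply: leq_sum => y _ /=; rewrite leq_mul2l; apply/orP; right.
by apply: (IH i.+1 m.+1) => // x' y'; rewrite addSnnS.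
Qed.

(* Of the two factors at the starting vertex, AM-GM leaves one squared; the
   remaining ones form a pendant path. *)
Lemma closed_walks_le Q m i : (forall i, \sum_x \sum_y step i x y ^ 2 <= Q) ->
  \sum_u walks i m.+2 u u <= Q * K ^ m.
Proof.
move=> hQ; rewrite -(leq_pmul2l (isT : 0 < 2)) [leqRHS]mul2n -addnn.
apply: (@leq_trans (\sum_u \sum_x \sum_y (step i u x ^ 2 * walks i.+2 m y u
                                         + step i.+1 x y ^ 2 * walks i.+2 m y u))).
  rewrite big_distrr; apply: leq_sum => u _ /=.
  rewrite big_distrr; apply: leq_sum => x _ /=.
  rewrite mulnA big_distrr; apply: leq_sum => y _ /=.
  rewrite -mulnDl !mulnA leq_mul2r -mulnA; apply/orP; right.
  exact: leq_of_leqif (nat_Cauchy _ _).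
under eq_bigr => u _ do (under eq_bigr => x _ do rewrite big_split /=; rewrite big_split /=).
rewrite big_split /=; apply: leq_add.
  apply: leq_trans (leq_mul (hQ i) (leqnn _)); rewrite big_distrl /=; apply: leq_sum => u _.
  rewrite big_distrl; apply: leq_sum => x _ /=; rewrite -big_distrr leq_mul2l /=.
  by rewrite walks_col orbT.
rewrite exchange_big /=; apply: leq_trans (leq_mul (hQ i.+1) (leqnn _)).
rewrite big_distrl /=; apply: leq_sum => x _; rewrite exchange_big /= big_distrl /=.
apply: leq_sum => y _; rewrite -big_distrr leq_mul2l /=.
by rewrite walks_row orbT.
Qed.
End Walks.

(** * Labellings of cycles *)

Section Labellings.
Variables (T : finType) (m : nat) (m0 : 0 < m).
Implicit Types f : {ffun 'I_m -> T}.

Definition cycle_edges f : {set {set T}} := [set [set f i; f (ordS i)] | i : 'I_m].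

Lemma periodicE f (i : 'I_m) : periodic m0 f i = f i.
Proof. by congr (f _); apply: val_inj; rewrite /= modn_small. Qed.

Lemma eq_periodic f i j : i = j %[mod m] -> periodic m0 f i = periodic m0 f j.
Proof. by move=> eq_ij; congr (f _); apply: val_inj. Qed.

Lemma periodic_inj f i j : injective f -> periodic m0 f i = periodic m0 f j -> i = j %[mod m].
Proof. by move=> f_inj /f_inj/(congr1 val). Qed.

Lemma cycle_edgesP f S :
  reflect (exists j, S = [set periodic m0 f j; periodic m0 f j.+1]) (S \in cycle_edges f).
Proof.
apply: (iffP imsetP) => [[i _ ->]|[j ->]].
  exists i; rewrite periodicE; congr [set _; _]; congr (f _); exact: val_inj.
exists (Ordinal (ltn_pmod j m0)) => //; congr [set _; _]; congr (f _); apply: val_inj => /=.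
by rewrite -addn1 -modnDml addn1.
Qed.

Lemma edge_in f j : [set periodic m0 f j; periodic m0 f j.+1] \in cycle_edges f.
Proof. by apply/cycle_edgesP; exists j. Qed.

Definition shift s f : {ffun 'I_m -> T} := [ffun i : 'I_m => periodic m0 f (i + s)].
(** The reflection sending [i] to [s - i]; the summand [m] keeps the subtraction natural. *)
Definition mirror s f : {ffun 'I_m -> T} := [ffun i : 'I_m => periodic m0 f (s + (m - i))].

Lemma periodic_shift s f j : periodic m0 (shift s f) j = periodic m0 f (j + s).
Proof. by rewrite {1}/periodic ffunE; apply: eq_periodic; rewrite /= modnDml. Qed.

Lemma add_modn_compl j : j + (m - j %% m) = (j %/ m).+1 * m.
Proof. by rewrite {1}(divn_eq j m) -addnA subnKC ?mulSn 1?addnC // ltnW // ltn_pmod. Qed.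

Lemma periodic_mirror s f j i : i + j = s %[mod m] ->
  periodic m0 (mirror s f) j = periodic m0 f i.
Proof.
move=> eq_ij; rewrite {1}/periodic ffunE; apply: eq_periodic => /=.
by rewrite -modnDml -eq_ij modnDml -addnA add_modn_compl addnC modnMDl.
Qed.

Lemma mirror_index s j : exists i, i + j = s %[mod m].
Proof.
by exists (s + (m - j %% m)); rewrite -addnA [_ + j]addnC add_modn_compl addnC modnMDl.
Qed.

Lemma cycle_edges_shift s f : cycle_edges (shift s f) = cycle_edges f.
Proof.
apply/setP => S; apply/cycle_edgesP/cycle_edgesP => -[j ->].
  by exists (j + s); rewrite !periodic_shift.
have [i eq_ij] := mirror_index j s.
exists i; rewrite !periodic_shift; congr [set _; _]; apply: eq_periodic => //.
by rewrite addSn -addn1 -[in RHS]addn1 -modnDml -eq_ij modnDml.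
Qed.

Lemma cycle_edges_mirror s f : cycle_edges (mirror s f) = cycle_edges f.
Proof.
apply/setP => S; apply/cycle_edgesP/cycle_edgesP => -[j ->].
  have [i eq_ij] := mirror_index s j.+1.
  exists i; rewrite (periodic_mirror _ eq_ij) setUC; congr [set _; _].
  by apply: periodic_mirror; rewrite addSnnS.
have [i eq_ij] := mirror_index s j.+1.
exists i; rewrite setUC; congr [set _; _]; apply/esym; apply: periodic_mirror.
  by rewrite addnC.
by rewrite addnC addSnnS.
Qed.

Lemma shift_inj s f : injective f -> injective (shift s f).
Proof.
move=> f_inj i j; rewrite -!periodicE !periodic_shift => /(periodic_inj f_inj)/eqP.
by rewrite eqn_modDr !modn_small // => /eqP; apply: val_inj.
Qed.

Lemma mirror_inj s f : injective f -> injective (mirror s f).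
Proof.
move=> f_inj i j; rewrite -!periodicE.
have [i' ei] := mirror_index s i; have [j' ej] := mirror_index s j.
rewrite (periodic_mirror _ ei) (periodic_mirror _ ej) => /(periodic_inj f_inj) eq_ij.
apply: val_inj; move/eqP: ei; rewrite -ej -modnDml eq_ij modnDml eqn_modDl.
by rewrite !modn_small // => /eqP.
Qed.

(* A labelling is determined by the edge set and its first two values: the next
   value is the other neighbour of the current one. *)
Lemma labelling_unique f f' : 2 < m -> injective f -> injective f' ->
  cycle_edges f = cycle_edges f' -> periodic m0 f 0 = periodic m0 f' 0 ->
  periodic m0 f 1 = periodic m0 f' 1 -> f = f'.
Proof.
move=> m3 f_inj f'_inj eqE e0 e1.
suff H j : periodic m0 f j = periodic m0 f' j /\ periodic m0 f j.+1 = periodic m0 f' j.+1.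
  by apply/ffunP => i; rewrite -!periodicE; have [] := H i.
elim: j => // j [IH0 IH1]; split=> //.
have neq (g : {ffun 'I_m -> T}) d i : injective g -> 0 < d < m -> periodic m0 g i != periodic m0 g (i + d).
  move=> g_inj /andP[d0 ltd]; apply/eqP => /(periodic_inj g_inj)/eqP.
  by rewrite -[i in X in X == _]addn0 eqn_modDl mod0n modn_small // eq_sym gtn_eqF.
have := edge_in f' j.+1; rewrite -eqE => /cycle_edgesP[i /setP eqS].
have := eqS (periodic m0 f' j.+1); rewrite !inE eqxx /= -IH1 => /esym/orP[]/eqP.
  move/(periodic_inj f_inj) => eq_ij.
  have /(eq_periodic f) eqS2 : j.+2 = i.+1 %[mod m] by rewrite -(addn1 j.+1) -(addn1 i) -modnDml eq_ij modnDml.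
  have := eqS (periodic m0 f i.+1); rewrite !inE eqxx orbT -eqS2 -IH1 => /orP[]/eqP // eq12.
  by have := neq f 1 j.+1 f_inj; rewrite addn1 eq12 eqxx => /(_ (ltnW m3)).
move/(periodic_inj f_inj)/eqP; rewrite -(addn1 i) -(addn1 j) eqn_modDr => /eqP/(eq_periodic f) eq_ij.
have := eqS (periodic m0 f i); rewrite !inE eqxx -eq_ij -IH1 => /orP[]/eqP.
  by have := neq f 1 j f_inj; rewrite addn1 => /(_ (ltnW m3))/eqP.
by have := neq f' 2 j f'_inj; rewrite addn2 IH0 => /(_ m3)/eqP.
Qed.
End Labellings.

Lemma sum_fibers (aT rT : finType) (h : aT -> rT) (A : {set aT}) (B : {set rT}) :
  \sum_(b in B) #|[set a in A | h a == b]| = #|[set a in A | h a \in B]|.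
Proof.
rewrite -sum1_card (partition_big h (mem B)) /= => [|a]; last by rewrite inE => /andP[].
apply: eq_bigr => b bB; rewrite -sum1_card; apply: eq_bigl => a; rewrite !inE -andbA.
by case: eqP => [->|]; rewrite ?bB ?andbT ?andbF.
Qed.

(** * Even cycles under parity-preserving symmetries *)

Section EvenCycles.
Variables (T : finType) (l : nat).
Hypothesis l2 : 1 < l.

Lemma double_gt0 : 0 < 2 * l. Proof. by rewrite muln_gt0 (ltnW l2). Qed.

Implicit Types (f : {ffun 'I_(2 * l) -> T}) (B : {set T}).
Notation per := (periodic double_gt0).

(** The [2l] of the [4l] symmetries of the cycle that send even positions to even positions. *)
Definition dihedral f (p : 'I_l * bool) :=
  if p.2 then mirror double_gt0 (2 * p.1) f else shift double_gt0 (2 * p.1) f.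

Lemma dihedral_edges f p : cycle_edges (dihedral f p) = cycle_edges f.
Proof.
by rewrite /dihedral; case: p.2; rewrite (cycle_edges_mirror, cycle_edges_shift).
Qed.

Lemma dihedral_injective f p : injective f -> injective (dihedral f p).
Proof.
by rewrite /dihedral => f_inj; case: p.2; [apply: mirror_inj | apply: shift_inj].
Qed.

Lemma dihedral_at0 f p : per (dihedral f p) 0 = per f (2 * p.1).
Proof.
rewrite /dihedral; case: p.2; last by rewrite periodic_shift.
by apply: periodic_mirror; rewrite addn0.
Qed.

Lemma dihedral_at1 f p :
  per (dihedral f p) 1 = per f (if p.2 then 2 * p.1 + (2 * l).-1 else 2 * p.1 + 1).
Proof.
rewrite /dihedral; case: p.2; last by rewrite periodic_shift addnC.
by apply: periodic_mirror; rewrite -addnA addn1 prednK ?double_gt0 // modnDr.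
Qed.

(** The value at 0 fixes the rotation and the value at 1 the orientation, since 1 and -1 differ
    modulo 2l. *)
Lemma dihedral_inj f : injective f -> injective (dihedral f).
Proof.
move=> f_inj [i b] [i' b'] eqD.
have /(periodic_inj f_inj) : per f (2 * i) = per f (2 * i') by rewrite -(dihedral_at0 f (i, b)) eqD dihedral_at0.
rewrite -!muln_modr !modn_small // => /eqP; rewrite eqn_mul2l /= => /eqP/val_inj eq_i.
move: eqD; rewrite -{i'}eq_i => eqD; congr (_, _).
have := dihedral_at1 f (i, b); rewrite eqD dihedral_at1 /=.
case: b b' {eqD} => [] [] // /(periodic_inj f_inj)/eqP.
  by rewrite eqn_modDl !modn_small; move: l2; clear; lia.
by rewrite eqn_modDl !modn_small; move: l2; clear; lia.
Qed.

Definition even_avoids B f := [forall j : 'I_l, per f (2 * j) \notin B].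

Lemma even_avoidsP B f : reflect (forall j, per f (2 * j) \notin B) (even_avoids B f).
Proof.
apply: (iffP forallP) => [av j|av j //].
have := av (Ordinal (ltn_pmod j (ltnW l2))).
by rewrite (eq_periodic double_gt0 f (j := 2 * j)) //= -!muln_modr modn_mod.
Qed.

Lemma dihedral_even f p j : exists i, per (dihedral f p) (2 * j) = per f (2 * i).
Proof.
rewrite /dihedral; case: p.2; last first.
  by exists (j + p.1); rewrite periodic_shift -mulnDr.
exists (p.1 + (l - j %% l)); apply: periodic_mirror.
rewrite -mulnDr -addnA [_ + j]addnC add_modn_compl ?(ltnW l2) //.
by rewrite mulnDr mulnCA addnC modnMDl.
Qed.

Lemma dihedral_avoids B f p : even_avoids B f -> even_avoids B (dihedral f p).
Proof. by move/even_avoidsP=> av; apply/even_avoidsP => j; have [i ->] := dihedral_even f p j. Qed.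

Lemma card_dihedral f : injective f -> #|dihedral f @: setT| = 2 * l.
Proof.
by move=> f_inj; rewrite card_imset ?cardsT ?card_prod ?card_ord ?card_bool 1?mulnC //; apply: dihedral_inj.
Qed.

(** One suitable labelling yields [2l] suitable ones through the parity-preserving symmetries. *)
Lemma card_good_cycles B (SS : {set {set {set T}}}) :
  {in SS, forall S, exists f, [/\ injective f, cycle_edges f = S & even_avoids B f]} ->
  #|SS| * (2 * l) <=
    #|[set f : {ffun 'I_(2 * l) -> T} | [&& injectiveb f, even_avoids B f & cycle_edges f \in SS]]|.
Proof.
move=> hS; pose A : {set {ffun 'I_(2 * l) -> T}} := [set f : {ffun _} | injectiveb f && even_avoids B f].
rewrite -sum_nat_const.
have -> : [set f : {ffun 'I_(2 * l) -> T} | [&& injectiveb f, even_avoids B f & cycle_edges f \in SS]] =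
    [set f in A | cycle_edges f \in SS] by apply/setP => f; rewrite !inE andbA.
rewrite -sum_fibers; apply: leq_sum => S SSS; have [f [f_inj eqS av]] := hS S SSS.
rewrite -[leqLHS](card_dihedral f_inj); apply/subset_leq_card/subsetP => _ /imsetP[p _ ->].
rewrite !inE dihedral_edges eqS eqxx dihedral_avoids // !andbT.
by apply/injectiveP; apply: dihedral_injective.
Qed.

(* If neither the even nor the odd positions avoid B, a rotation brings an
   even position in B to 0. *)
Lemma card_bad_cycles B (SS : {set {set {set T}}}) :
  {in SS, forall S, exists2 f : {ffun 'I_(2 * l) -> T}, injective f & cycle_edges f = S} ->
  {in SS, forall S (f : {ffun 'I_(2 * l) -> T}), injective f -> cycle_edges f = S -> ~~ even_avoids B f} ->
  #|SS| <= \sum_(p < l) #|[set f : {ffun 'I_(2 * l) -> T} | [&& injectiveb f, cycle_edges f \in SS,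
                              per f 0 \in B & per f (2 * p).+1 \in B]]|.
Proof.
move=> hS bad.
apply: (@leq_trans #|\bigcup_(p < l) [set cycle_edges f | f in [set f : {ffun 'I_(2 * l) -> T} |
    [&& injectiveb f, cycle_edges f \in SS, per f 0 \in B & per f (2 * p).+1 \in B]]]|).
  apply/subset_leq_card/subsetP => S SSS; have [f f_inj eqS] := hS S SSS.
  have := bad S SSS f f_inj eqS; rewrite negb_forall => /existsP[i]; rewrite negbK => iB.
  pose f1 := shift double_gt0 (2 * i).+1 f.
  have := bad S SSS f1 (shift_inj f_inj); rewrite cycle_edges_shift => /(_ eqS).
  rewrite negb_forall => /existsP[j]; rewrite negbK periodic_shift addnS => jB.
  apply/bigcupP; exists j => //; apply/imsetP; exists (shift double_gt0 (2 * i) f).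
    rewrite inE cycle_edges_shift eqS SSS !periodic_shift add0n iB addSn jB !andbT.
    by apply/injectiveP; apply: shift_inj.
  by rewrite cycle_edges_shift.
elim/big_rec2: _ => [|p U c _ le_c]; first by rewrite cards0.
exact: leq_trans (leq_card_setU _ _) (leq_add (leq_imset_card _ _) le_c).
Qed.
End EvenCycles.

(** * The upper bound *)

Section UpperBound.
Variables (T : finType) (e : rel T).
Hypothesis e_sym : symmetric e.
Hypothesis e_irr : irreflexive e.
Variable k : nat.
Hypothesis k2 : 2 <= k.
Hypothesis no_cycle : forall s, size s = 2 * k -> uniq s -> ~~ cycle e s.
Variable l : nat.
Hypothesis l2 : 1 < l.
Variable M : nat.
Hypothesis M0 : 0 < M.
Notation n := #|T|.
Notation C := (fat_const k).
Notation per := (periodic (double_gt0 l2)).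

Definition large_verts : {set T} := [set a | n <= M * #|nbrs e a|].
Notation B := large_verts.

(** A double step between even positions; [x != y] holds on a cycle and removes the diagonal
    codegrees, which are degrees. *)
Definition hop x w y := [&& e x w, e w y & x != y].
Definition hop_avoiding (i : nat) x w y := [&& hop x w y, x \notin B & y \notin B].
(** The walk starts in [B], and its vertex at the odd position [2p + 1] lies in [B]. *)
Definition hop_through p i x w y :=
  [&& hop x w y, (i == 0) ==> (x \in B) & (i == p) ==> (w \in B)].

Lemma step_codeg (c : nat -> T -> T -> T -> bool) i x y :
  (forall w, c i x w y -> hop x w y) ->
  step c i x y <= if y != x then codeg e x y else 0.
Proof.
move=> sub; rewrite /step /codeg; case: ifP => [_|/negbFE/eqP yx]; last subst y.
  apply/subset_leq_card/subsetP => w; rewrite !inE => /sub/and3P[-> wy _].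
  by rewrite e_sym wy.
rewrite leqn0 cards_eq0; apply/eqP/setP => w; rewrite !inE; apply/negP => /sub.
by rewrite /hop eqxx !andbF.
Qed.

Lemma stepC (c : nat -> T -> T -> T -> bool) i x y :
  (forall w, c i x w y = c i y w x) -> step c i x y = step c i y x.
Proof. by move=> cC; apply: eq_card => w; rewrite !inE cC. Qed.

Lemma sum_step (c : nat -> T -> T -> T -> bool) i x :
  (forall w y, c i x w y -> hop x w y) ->
  \sum_y step c i x y <= \sum_(y | y != x) codeg e x y.
Proof.
move=> sub; rewrite [leqRHS]big_mkcond; apply: leq_sum => y _.
by apply: step_codeg => w; apply: sub.
Qed.

Lemma hop_avoiding_row i x :
  \sum_y step hop_avoiding i x y <= k.-1 * n + C * (n %/ M).
Proof.
case: (boolP (x \in B)) => xB.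
  rewrite big1 // => y _; apply/eqP; rewrite cards_eq0; apply/eqP/setP => w.
  by rewrite !inE /hop_avoiding xB !andbF.
apply: leq_trans (sum_step _) _ => [w y /and3P[]//|].
apply: leq_trans (codeg_row e_sym e_irr k2 no_cycle x) _.
rewrite leq_add2l leq_mul2l; apply/orP; right; rewrite leq_divRL //.
by move: xB; rewrite inE -ltnNge mulnC => /ltnW.
Qed.

Lemma hop_avoiding_sqr i :
  \sum_x \sum_y step hop_avoiding i x y ^ 2
    <= 2 * (k.-1 * n) ^ 2 + (4 * k).+1 * C * sum_deg e.
Proof.
apply: leq_trans (sum_codeg_sqr e_sym e_irr k2 no_cycle); apply: leq_sum => x _.
rewrite [leqRHS]big_mkcond; apply: leq_sum => y _.
have : step hop_avoiding i x y <= if y != x then codeg e x y else 0.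
  by apply: step_codeg => w /and3P[].
by case: ifP => _; rewrite ?leqn0 => h; [rewrite leq_exp2r | rewrite (eqP h)].
Qed.

Lemma codeg_row_all x : \sum_(y | y != x) codeg e x y <= (k + C) * n.
Proof.
apply: leq_trans (codeg_row e_sym e_irr k2 no_cycle x) _; rewrite mulnDl.
apply: leq_add; first by rewrite leq_mul2r leq_pred orbT.
by rewrite leq_mul2l max_card orbT.
Qed.

Lemma hop_through_row p i x : \sum_y step (hop_through p) i x y <= (k + C) * n.
Proof. by apply: leq_trans (sum_step _) (codeg_row_all x) => w y /and3P[]. Qed.

Lemma hop_through_col p i y : \sum_x step (hop_through p) i x y <= (k + C) * n.
Proof.
apply: leq_trans (codeg_row_all y); rewrite [leqRHS]big_mkcond; apply: leq_sum => x _.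
by rewrite eq_sym codegC; apply: step_codeg => w /and3P[].
Qed.

(** There are [#|B|] starts, the entries of factor [p] are at most [#|B|], and each of the other
    [l.-1] factors costs a row or column sum. *)
Lemma closed_through p : p < l ->
  \sum_u walks (hop_through p) 0 l u u <= #|B| * (#|B| * ((k + C) * n) ^ l.-1).
Proof.
move=> lt_pl; rewrite -sum_nat_const [leqRHS]big_mkcond; apply: leq_sum => u _.
case: ifP => uB; last first.
  rewrite leqn0; case: l l2 => // l' _ /=; rewrite sum_nat_eq0; apply/forallP => y /=.
  rewrite muln_eq0 cards_eq0; apply/orP; left; apply/eqP/setP => w.
  by rewrite !inE /hop_through uB !andbF.
apply: (walks_entry (hop_through_row p) (hop_through_col p) u u lt_pl) => x y.
by apply/subset_leq_card/subsetP => w; rewrite inE => /and3P[_ _]; rewrite eqxx.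
Qed.

Lemma num_cycles_upper (SS : {set {set {set T}}}) :
  {in SS, forall S, exists2 f : {ffun 'I_(2 * l) -> T}, injective f & cycle_edges f = S} ->
  (forall (f : {ffun 'I_(2 * l) -> T}) j, cycle_edges f \in SS -> e (per f j) (per f j.+1)) ->
  #|SS| * (2 * l) <=
    (2 * (k.-1 * n) ^ 2 + (4 * k).+1 * C * sum_deg e)
       * (k.-1 * n + C * (n %/ M)) ^ (l - 2)
    + l * (#|B| * (#|B| * ((k + C) * n) ^ l.-1)) * (2 * l).
Proof.
move=> hS he.
(* A cycle outside [good] meets [B] at an even position in every labelling, hence, by an odd shift,
   in both classes. *)
pose good := [set S in SS | [exists f : {ffun 'I_(2 * l) -> T},
  [&& injectiveb f, cycle_edges f == S & even_avoids l2 B f]]].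
have neq (f : {ffun 'I_(2 * l) -> T}) j : injectiveb f -> per f j != per f j.+2.
  move/injectiveP=> f_inj; apply/eqP => /(periodic_inj f_inj)/eqP.
  rewrite -[j in X in X == _]addn0 -[j.+2]addn2 eqn_modDl mod0n modn_small //.
  by move: l2; clear; lia.
rewrite -(cardsID good SS) mulnDl; apply: leq_add; last first.
  rewrite leq_mul2r; apply/orP; right.
  apply: leq_trans (@card_bad_cycles _ _ l2 B _ _ _) _.
  - by move=> S /setDP[SSS _]; apply: hS.
  - move=> S /setDP[SSS]; rewrite inE SSS /= => nex f f_inj eqS; apply: contra nex => av.
    by apply/existsP; exists f; rewrite eqS eqxx av !andbT; apply/injectiveP.
  have <- : \sum_(p < l) #|B| * (#|B| * ((k + C) * n) ^ l.-1) =
      l * (#|B| * (#|B| * ((k + C) * n) ^ l.-1)) by rewrite sum_nat_const card_ord.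
  apply: leq_sum => p _.
  apply: leq_trans (closed_through (ltn_ord p)); apply: (@card_closed_walks _ _ _ (double_gt0 l2)) => f j.
  rewrite inE => /and4P[f_inj /setDP[fSS _] f0 fp] ltj; cbv zeta.
  rewrite /hop_through /hop !he // /= neq //=.
  by apply/andP; split; apply/implyP => /eqP->; rewrite ?muln0.
have -> : SS :&: good = good.
  by apply/setIidPr/subsetP => S; rewrite inE => /andP[].
apply: leq_trans (@card_good_cycles _ _ l2 B _ _) _.
  move=> S; rewrite inE => /andP[_ /existsP[f /and3P[/injectiveP f_inj /eqP eqS av]]].
  by exists f.
apply: (@leq_trans (\sum_u walks hop_avoiding 0 l u u)).
  apply: (@card_closed_walks _ _ _ (double_gt0 l2)) => f j.
  rewrite inE => /and3P[f_inj av]; rewrite inE => /andP[fSS _] ltj; cbv zeta.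
  rewrite /hop_avoiding /hop !he // neq //=; move/even_avoidsP: av => av.
  have -> : (2 * j).+2 = 2 * j.+1 by rewrite mulnS.
  by rewrite !av.
case: l l2 => [|[|m]] // _; rewrite subn2 /=.
apply: closed_walks_le => [i x|i y|i]; [exact: hop_avoiding_row| |exact: hop_avoiding_sqr].
(* A reversed hop is again a hop, so column sums are row sums. *)
apply: leq_trans (hop_avoiding_row i y); apply: leq_sum => x _.
rewrite (@stepC _ i x y) // => w.
rewrite /hop_avoiding /hop (e_sym x w) (e_sym w y) (eq_sym x).
by case: (e w x); case: (e y w); rewrite ?andbF // [(x \notin B) && _]andbC.
Qed.
End UpperBound.

Import Order.TTheory GRing.Theory Num.Theory.

(** * Edge sets, adjacency and cycle copies *)

Definition adj n (G : {set {set 'I_n}}) : rel 'I_n := fun x y => [set x; y] \in G.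

Lemma adj_sym n (G : {set {set 'I_n}}) : symmetric (adj G).
Proof. by move=> x y; rewrite /adj setUC. Qed.

Lemma adj_irr n (G : {set {set 'I_n}}) : simple_graph G -> irreflexive (adj G).
Proof.
move/forallP=> simpG x; apply/negP => xG; have := simpG [set x; x].
by move: xG; rewrite /adj => ->; rewrite setUid cards1.
Qed.

Lemma cycle_nth (T : Type) (e : rel T) x0 (s : seq T) i :
  cycle e s -> i < size s -> e (nth x0 s i) (nth x0 s (i.+1 %% size s)).
Proof.
case: s => // x p /(pathP x0) cyc ltip; have := cyc i; rewrite size_rcons => /(_ ltip).
rewrite -rcons_cons !nth_rcons /= in ltip *; rewrite ltip.
move: ltip; rewrite ltnS leq_eqVlt => /predU1P[->|ltip]; first by rewrite ltnn eqxx modnn.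
by rewrite ltip modn_small.
Qed.

Lemma cycle_copiesP n m (m0 : 0 < m) (G : {set {set 'I_n}}) S :
  reflect (exists f : {ffun 'I_m -> 'I_n}, [/\ injective f, S = cycle_edges f &
            forall j, adj G (periodic m0 f j) (periodic m0 f j.+1)])
          (S \in cycle_copies m G).
Proof.
rewrite inE; apply: (iffP andP) => [[sSG /existsP[f /andP[/injectiveP f_inj /eqP eqS]]]|].
  by exists f; split=> // j; apply: (subsetP sSG); rewrite eqS; apply: (edge_in m0).
case=> f [f_inj -> adjf]; split.
  by apply/subsetP => _ /(cycle_edgesP m0)[j ->]; apply: adjf.
by apply/existsP; exists f; rewrite eqxx andbT; apply/injectiveP.
Qed.

Lemma no_cycle_seq n k (G : {set {set 'I_n}}) s : 0 < k ->
  num_cycles k G = 0 -> size s = k -> uniq s -> ~~ cycle (adj G) s.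
Proof.
move=> k0 /eqP; rewrite cards_eq0 => /eqP none szs us; apply/negP => cyc.
case: s szs us cyc => [|x0 s']; first by move=> szs; rewrite -szs in k0.
move: (x0 :: s') => s szs us cyc.
pose f := [ffun i : 'I_k => nth x0 s i].
have: cycle_edges f \in cycle_copies k G.
  apply/(cycle_copiesP k0); exists f; split=> // [i j|j].
    rewrite !ffunE => /eqP; rewrite nth_uniq ?szs // => /eqP; exact: val_inj.
  rewrite /periodic !ffunE /= -addn1 -modnDml addn1.
  by have := cycle_nth (i := j %% k) x0 cyc; rewrite szs; apply; rewrite ltn_pmod.
by rewrite none inE.
Qed.

(** The multiplier [M ^ l.-1] clears the quotient [n %/ M]: one factor [M] goes to the sum of
    squared codegrees and one to each of the [l - 2] row sums. [D] dominates the error constants, so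
    the main term carries the correction [(1 + D/M)^(l-1)]. *)
Lemma num_cycles_bound n k l M K D (G : {set {set 'I_n}}) : 2 <= k -> 2 <= l -> 0 < M ->
  M ^ 2 <= n -> 0 < n -> simple_graph G -> num_cycles (2 * k) G = 0 ->
  K = k + fat_const k -> D = (4 * k).+1 * fat_const k * K ->
  M ^ l.-1 * (num_cycles (2 * l) G * (2 * l)) <=
    2 * k.-1 ^ l * n ^ l * (M + D) ^ l.-1
    + M ^ l.-1 * (l * (M ^ 2 * K * (M ^ 2 * K * K ^ l.-1)) * (2 * l)) * n ^ l.-1.
Proof.
move=> k2 l2 M0 leMn n0 simpG freeG eqK eqD.
have e_sym := @adj_sym n G; have e_irr := adj_irr simpG.
have noC s : size s = 2 * k -> uniq s -> ~~ cycle (adj G) s.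
  by apply: (no_cycle_seq _ freeG); rewrite muln_gt0 (ltnW k2).
pose l0 : 0 < 2 * l := double_gt0 l2.
have isC : {in cycle_copies (2 * l) G, forall S,
    exists2 f : {ffun 'I_(2 * l) -> 'I_n}, injective f & cycle_edges f = S}.
  by move=> S /(cycle_copiesP l0)[f [f_inj -> _]]; exists f.
have adjC (f : {ffun 'I_(2 * l) -> 'I_n}) j : cycle_edges f \in cycle_copies (2 * l) G ->
    adj G (periodic l0 f j) (periodic l0 f j.+1).
  case/(cycle_copiesP l0) => f' [_ eqE adjf'].
  have := edge_in l0 f j; rewrite eqE => /(cycle_edgesP l0)[j' eqS].
  by rewrite /adj eqS; apply: adjf'.
have := num_cycles_upper e_sym e_irr k2 noC M0 isC adjC.
rewrite -/(num_cycles (2 * l) G) card_ord.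
move: (sum_deg_small e_sym e_irr k2 noC M) (card_big_deg e_sym e_irr k2 noC M).
rewrite card_ord -/(large_verts (adj G) M) -eqK.
have -> : #|[set a | n <= M * #|nbrs (adj G) a|]| = #|large_verts (adj G) M|.
  by apply: eq_card => a; rewrite !inE card_ord.
move: (num_cycles _ _) (sum_deg _) #|large_verts _ _| => N s b hs hb.
have {hb} hb : b <= M ^ 2 * K.
  by rewrite -(@leq_pmul2l (n ^ 2)) ?expn_gt0 ?n0 // (leq_trans hb) // mulnA mulnC.
have K0 : 0 < K by rewrite eqK; clear -k2; lia.
have C0 : 0 < fat_const k by rewrite /fat_const; clear -k2; nia.
have {hs} hs : M * s <= K * n ^ 2.
  (* The assumption [M ^ 2 <= n] absorbs the linear term of [sum_deg_small]. *)
  have h1 : M ^ 2 * n <= n ^ 2 by rewrite -[leqRHS]mulnn leq_mul2r leMn orbT.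
  have h2 : n ^ 2 <= K * n ^ 2 by rewrite leq_pmull.
  by move: hs h1 h2; clear; rewrite -mulnA; lia.
move=> upper.
apply: leq_trans (leq_mul (leqnn _) upper) _; rewrite mulnDr; apply: leq_add; last first.
  rewrite -[leqRHS]mulnA leq_mul2l; apply/orP; right.
  rewrite [leqRHS]mulnAC leq_mul2r; apply/orP; right.
  rewrite -[leqRHS]mulnA leq_mul2l; apply/orP; right.
  rewrite expnMn -[leqRHS]mulnA; apply: leq_mul => //.
  by rewrite -[leqRHS]mulnA; apply: leq_mul.
have c0 : 0 < k.-1 by clear -k2; lia.
have -> : M ^ l.-1 = M * M ^ (l - 2).
  by rewrite -expnS; congr (_ ^ _); clear -l2; lia.
rewrite mulnACA -expnMn.
have -> : 2 * k.-1 ^ l * n ^ l * (M + D) ^ l.-1 =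
   (2 * k.-1 ^ 2 * n ^ 2 * (M + D)) * (k.-1 * n * (M + D)) ^ (l - 2).
  have -> : l.-1 = (l - 2).+1 by clear -l2; lia.
  rewrite -{1 2}(subnK l2); move: (l - 2) (k.-1) (M + D) => j a x.
  rewrite !expnD (expnS x) !expnMn; move: (a ^ j) (n ^ j) (x ^ j) => p q r.
  by rewrite -!mulnn; ring.
apply: leq_mul.
  rewrite !expnMn; have : D * n ^ 2 <= k.-1 ^ 2 * (D * n ^ 2) by rewrite leq_pmull ?expn_gt0 ?c0.
  have : (4 * k).+1 * fat_const k * (M * s) <= D * n ^ 2.
    by rewrite eqD -[leqRHS]mulnA leq_mul2l hs orbT.
  move: (k.-1 ^ 2) (n ^ 2) ((4 * k).+1 * fat_const k) => x y z; clear; nia.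
have le1 : M * (k.-1 * n + fat_const k * (n %/ M)) <= k.-1 * n * (M + D).
  rewrite !mulnDr; apply: leq_add; first by rewrite mulnC.
  have leCD : fat_const k <= D by rewrite eqD mulnAC leq_pmull // muln_gt0 K0.
  rewrite mulnCA [M * _]mulnC; apply: leq_trans (leq_mul leCD (leq_divM n M)) _.
  by rewrite mulnC leq_mul2r leq_pmull // orbT.
by case: (l - 2) => // j; rewrite leq_exp2r.
Qed.

Lemma ex_cycle_bound n k l M K D : 2 <= k -> 2 <= l -> 0 < M -> M ^ 2 <= n -> 0 < n ->
  K = k + fat_const k -> D = (4 * k).+1 * fat_const k * K ->
  M ^ l.-1 * (ex_cycle n l k * (2 * l)) <=
    2 * k.-1 ^ l * n ^ l * (M + D) ^ l.-1
    + M ^ l.-1 * (l * (M ^ 2 * K * (M ^ 2 * K * K ^ l.-1)) * (2 * l)) * n ^ l.-1.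
Proof.
move=> k2 l2 M0 leMn n0 eqK eqD; set X := leqRHS.
have pos : 0 < 2 * l * M ^ l.-1 by rewrite muln_gt0 (double_gt0 l2) expn_gt0 M0.
rewrite mulnC -mulnA -leq_divRL //.
apply/bigmax_leqP => G /andP[simpG /eqP freeG]; rewrite leq_divRL // mulnA mulnC.
exact: (num_cycles_bound k2 l2 M0 leMn n0 simpG freeG).
Qed.

(** * Lower bound constructions *)

Definition graph_of n (e : rel 'I_n) : {set {set 'I_n}} :=
  [set [set p.1; p.2] | p in [set p : 'I_n * 'I_n | e p.1 p.2]].

Lemma adj_graph_of n (e : rel 'I_n) : symmetric e -> adj (graph_of e) =2 e.
Proof.
move=> e_sym x y; apply/imsetP/idP => [[[a b]]|exy]; last by exists (x, y); rewrite ?inE.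
rewrite inE /= => eab eqS.
have /set2P x_in : x \in [set a; b] by rewrite -eqS set21.
have /set2P y_in : y \in [set a; b] by rewrite -eqS set22.
have /set2P a_in : a \in [set x; y] by rewrite eqS set21.
have /set2P b_in : b \in [set x; y] by rewrite eqS set22.
case: x_in y_in a_in b_in eab {eqS} => -> [] -> //.
- by move=> _ [] ->.
- by move=> _ _; rewrite e_sym.
- by case=> ->.
Qed.

Lemma simple_graph_of n (e : rel 'I_n) : irreflexive e -> simple_graph (graph_of e).
Proof.
move=> e_irr; apply/forallP => S; apply/implyP => /imsetP[[a b]]; rewrite inE /= => eab ->.
have /negPf ab : a != b by apply: contraTneq eab => ->; rewrite e_irr.
by rewrite cards2 ab.
Qed.

Lemma ex_cycle_ge n k l (e : rel 'I_n) : symmetric e -> irreflexive e ->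
  (forall f : {ffun 'I_(2 * k) -> 'I_n}, forall k0 : 0 < 2 * k, injective f ->
     (forall j, e (periodic k0 f j) (periodic k0 f j.+1)) -> False) ->
  0 < k -> num_cycles (2 * l) (graph_of e) <= ex_cycle n l k.
Proof.
move=> e_sym e_irr free k0; apply: (leq_bigmax_cond (F := fun G => num_cycles (2 * l) G)).
rewrite simple_graph_of //= cards_eq0; apply/eqP/setP => S; rewrite in_set0; apply/negP.
have k20 : 0 < 2 * k by rewrite muln_gt0.
case/(cycle_copiesP k20) => f [f_inj _ adjf]; apply: (free f k20 f_inj) => j.
by rewrite -adj_graph_of.
Qed.

(** * Labellings alternating between two classes *)

Section Alternating.
Variables (T : finType) (P : pred T).

Lemma alternating (g : nat -> T) : (forall j, P (g j) != P (g j.+1)) ->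
  forall j, P (g j) = odd j (+) P (g 0).
Proof.
move=> alt; elim=> [|j IH] //=.
by have := alt j; rewrite IH; case: (odd j); case: (P (g 0)); case: (P _).
Qed.

Variables (l : nat) (l2 : 1 < l).
Notation per := (periodic (double_gt0 l2)).

(** Two such labellings of one cycle differ by a parity-preserving symmetry: the first edge of [f]
    joins positions [j] and [j.+1] of [f0], and the parity of [j] decides between reflection and
    rotation. *)
Lemma card_alternating_labellings (A : {set {ffun 'I_(2 * l) -> T}}) S :
  {in A, forall f : {ffun 'I_(2 * l) -> T}, [/\ injective f, P (per f 0) & forall j, P (per f j) != P (per f j.+1)]} ->
  #|[set f in A | cycle_edges f == S]| <= 2 * l.
Proof.
move=> hA; case: (pickP [pred f in A | cycle_edges f == S]) => [f0|none]; last first.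
  rewrite (_ : [set f in A | _] = set0) ?cards0 //.
  by apply/setP => f; rewrite !inE; apply: none.
case/andP=> /= /hA[f0_inj P0 alt0] /eqP <-.
rewrite -[leqRHS](card_dihedral l2 f0_inj); apply/subset_leq_card/subsetP => f.
rewrite inE => /andP[/hA[f_inj Pf alt] /eqP eqE].
have := edge_in (double_gt0 l2) f 0; rewrite eqE => /(cycle_edgesP (double_gt0 l2))[j /setP eqS].
have par i : P (per f0 i) = ~~ odd i by rewrite (alternating alt0) P0 addbT.
have nP1 : P (per f 1) = false by have := alt 0; rewrite Pf; case: (P (per f 1)).
have ord i : 2 * (i %% l) = 2 * i %[mod 2 * l] by rewrite muln_modr modn_mod.
have uniq_f p : per f 0 = per (dihedral l2 f0 p) 0 -> per f 1 = per (dihedral l2 f0 p) 1 ->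
    f \in dihedral l2 f0 @: setT.
  move=> e0 e1; apply/imsetP; exists p => //.
  apply: (@labelling_unique _ _ (double_gt0 l2)) => //; first by move: l2; clear; lia.
    exact: dihedral_injective.
  by rewrite dihedral_edges.
have /esym := eqS (per f 0); have /esym := eqS (per f 1); rewrite !inE !eqxx orbT /=.
move=> in1 in0; have l0 : 0 < l by exact: ltnW.
(* For odd [j] the edge is traversed backwards, giving the reflection that sends 0 to [j.+1]; for
   even [j] it is the rotation by [j]. *)
case: (boolP (odd j)) => oj.
  have {in0} e0 : per f 0 = per f0 j.+1.
    by case/orP: in0 => /eqP // e0; move: Pf; rewrite e0 par oj.
  have {in1} e1 : per f 1 = per f0 j.
    by case/orP: in1 => /eqP // e1; move: nP1; rewrite e1 par /= oj.
  have ej : j.+1 = 2 * (j.+1)./2 by rewrite mul2n even_halfK //= negbK.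
  apply: (uniq_f (Ordinal (ltn_pmod (j.+1)./2 l0), true)).
    by rewrite dihedral_at0 e0 {1}ej; apply: eq_periodic; rewrite /= ord.
  rewrite dihedral_at1 e1 /=; apply: eq_periodic; rewrite -modnDml ord -ej modnDml.
  by rewrite addSnnS prednK ?double_gt0 // modnDr.
have {in0} e0 : per f 0 = per f0 j.
  by case/orP: in0 => /eqP // e0; move: Pf; rewrite e0 par /= negbK (negPf oj).
have {in1} e1 : per f 1 = per f0 j.+1.
  by case/orP: in1 => /eqP // e1; move: nP1; rewrite e1 par oj.
have ej : j = 2 * j./2 by rewrite mul2n even_halfK.
apply: (uniq_f (Ordinal (ltn_pmod j./2 l0), false)).
  by rewrite dihedral_at0 e0 {1}ej; apply: eq_periodic; rewrite /= ord.
rewrite dihedral_at1 e1 /=; apply: eq_periodic; rewrite -modnDml ord -ej modnDml.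
by rewrite addn1.
Qed.
End Alternating.

(** * The complete bipartite graph *)

Definition bip c n : rel 'I_n := fun x y => (x < c) != (y < c).

Lemma bip_sym c n : symmetric (@bip c n).
Proof. by move=> x y; rewrite /bip eq_sym. Qed.

Lemma bip_irr c n : irreflexive (@bip c n).
Proof. by move=> x; rewrite /bip eqxx. Qed.

(** The cycle would put [k] distinct vertices below [c]; [b] is the parity of the positions lying
    there. *)
Lemma bip_free c n k (f : {ffun 'I_(2 * k) -> 'I_n}) (k0 : 0 < 2 * k) :
  c < k -> injective f -> (forall j, bip c (periodic k0 f j) (periodic k0 f j.+1)) -> False.
Proof.
move=> lt_ck f_inj alt; pose P (x : 'I_n) := x < c.
have par := alternating (P := P) alt.
pose b : bool := ~~ P (periodic k0 f 0).
pose h i := periodic k0 f (2 * i + b).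
have hP (i : 'I_k) : h i < c.
  by rewrite -[_ < c]/(P (h i)) par /b mul2n oddD odd_double /=; case: (P _).
have h_inj : injective (fun i : 'I_k => Ordinal (hP i)).
  move=> i j /(congr1 val) /= /val_inj /(periodic_inj f_inj)/eqP.
  by rewrite eqn_modDr !modn_small ?ltn_mul2l ?ltn_ord // eqn_mul2l => /eqP/val_inj ->.
by have := leq_card _ h_inj; rewrite !card_ord leqNgt lt_ck.
Qed.

Lemma ltn_half_double l (i : 'I_(2 * l)) : i./2 < l.
Proof. by rewrite ltn_half_double -mul2n. Qed.

Definition half_ord l (i : 'I_(2 * l)) : 'I_l := Ordinal (ltn_half_double i).

Lemma half_ord_eq l (i j : 'I_(2 * l)) : odd i = odd j -> half_ord i = half_ord j -> i = j.
Proof.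
move=> eq_odd /(congr1 val) /= eq_half; apply: val_inj.
by rewrite /= -(odd_double_half i) -(odd_double_half j) eq_odd eq_half.
Qed.

Lemma odd_mod_double i l : odd (i %% (2 * l)) = odd i.
Proof. by rewrite [in RHS](divn_eq i (2 * l)) oddD oddM oddM /= andbF. Qed.

(** Interleaving injections into the two classes gives all these labellings with position 0 in the
    first class, at most [2l] for each cycle. *)
Lemma num_cycles_bip c d l : 1 < l ->
  c ^_ l * d ^_ l <= num_cycles (2 * l) (graph_of (@bip c (c + d))) * (2 * l).
Proof.
move=> l2; pose P (x : 'I_(c + d)) := x < c.
pose join (p : {ffun 'I_l -> 'I_c} * {ffun 'I_l -> 'I_d}) : {ffun 'I_(2 * l) -> 'I_(c + d)} :=
  [ffun i : 'I_(2 * l) => if odd i then rshift c (p.2 (half_ord i)) else lshift d (p.1 (half_ord i))].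
pose D := setX [set p : {ffun 'I_l -> 'I_c} | injectiveb p] [set q : {ffun 'I_l -> 'I_d} | injectiveb q].
have joinP p j : P (periodic (double_gt0 l2) (join p) j) = ~~ odd j.
  rewrite /P /periodic ffunE /= odd_mod_double; case: (odd j) => /=; last exact: ltn_ord.
  by rewrite ltnNge leq_addr.
have join_inj : injective join.
  move=> [p q] [p' q'] /ffunP eqJ; congr (_, _); apply/ffunP => i;
    have od : odd (2 * i) = false by rewrite mul2n odd_double.
    have lt : 2 * i < 2 * l by rewrite ltn_mul2l ltn_ord.
    have := eqJ (Ordinal lt); rewrite !ffunE /= od => /lshift_inj.
    by rewrite (_ : half_ord _ = i) //; apply: val_inj; rewrite /= mul2n doubleK.
  have lt : (2 * i).+1 < 2 * l by have := ltn_ord i; clear; lia.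
  have := eqJ (Ordinal lt); rewrite !ffunE /= od => /rshift_inj.
  by rewrite (_ : half_ord _ = i) //; apply: val_inj; rewrite /= mul2n uphalf_double.
have cD : #|D| = c ^_ l * d ^_ l.
  by rewrite cardsX !card_inj_ffuns !card_ord.
rewrite -cD -(card_imset _ join_inj).
have JP : {in join @: D, forall f : {ffun 'I_(2 * l) -> 'I_(c + d)},
    [/\ injective f, P (periodic (double_gt0 l2) f 0) &
        forall j, P (periodic (double_gt0 l2) f j) != P (periodic (double_gt0 l2) f j.+1)]}.
  move=> f /imsetP[[p q] /setXP[]]; rewrite !inE /= => /injectiveP p_inj /injectiveP q_inj eq_f.
  subst f.
  split=> [i j||j]; [|by rewrite joinP|by rewrite !joinP /=; case: (odd j)].
  rewrite !ffunE /=; case oi: (odd i); case oj: (odd j).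
  - by move=> /rshift_inj/q_inj; apply: half_ord_eq; rewrite oi oj.
  - by move/(congr1 val) => /= eq_ij; have := ltn_ord (p (half_ord j)); rewrite -eq_ij ltnNge leq_addr.
  - by move/(congr1 val) => /= eq_ij; have := ltn_ord (p (half_ord i)); rewrite eq_ij ltnNge leq_addr.
  - by move=> /lshift_inj/p_inj; apply: half_ord_eq; rewrite oi oj.
rewrite /num_cycles -sum_nat_const.
apply: (@leq_trans (\sum_(S in cycle_copies (2 * l) (graph_of (@bip c (c + d))))
                      #|[set f in join @: D | cycle_edges f == S]|)); last first.
  by apply: leq_sum => S _; apply: card_alternating_labellings JP.
rewrite sum_fibers; apply/subset_leq_card/subsetP => f fJ; rewrite inE fJ /=.
have [f_inj _ alt] := JP f fJ; apply/(cycle_copiesP (double_gt0 l2)); exists f; split=> // j.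
by rewrite adj_graph_of; [apply: alt | apply: bip_sym].
Qed.

(** * The cyclic chain of hubs *)

Definition spoke l x v := [&& x < l, l <= v & (v %% l == x) || (v.+1 %% l == x)].
(** A cycle of length 2l with every second vertex blown up: the hubs are the vertices below [l], and
    the residue modulo [l] of any other vertex names the gap it fills. *)
Definition necklace l n : rel 'I_n := fun x y => spoke l x y || spoke l y x.

Lemma necklace_sym l n : symmetric (@necklace l n).
Proof. by move=> x y; rewrite /necklace orbC. Qed.

Lemma necklace_irr l n : irreflexive (@necklace l n).
Proof. by move=> x; rewrite /necklace /spoke orbb; case: leqP. Qed.

Lemma necklace_alt l n (x y : 'I_n) : necklace l x y -> (x < l) != (y < l).
Proof. by case/orP=> /and3P[lt le _]; rewrite lt ltnNge le. Qed.

(** Successive hubs differ by one modulo [l], and the direction never reverses because hubs two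
    apart are distinct, by [3 <= k]. After [k] turns the hub has moved by [k] modulo [l], which is
    nonzero as [0 < k < l]. *)
Lemma necklace_free_hub l n k (g : nat -> 'I_n) : 3 <= k < l ->
  (forall i j, g i = g j -> i = j %[mod 2 * k]) -> g (2 * k) = g 0 -> g 0 < l ->
  (forall j, necklace l (g j) (g j.+1)) -> False.
Proof.
case/andP=> k3 lt_kl g_inj gk g0 adjg; have l0 : 0 < l by apply: leq_ltn_trans lt_kl.
have par j : (g j < l) = ~~ odd j.
  by rewrite (alternating (P := fun x : 'I_n => x < l)) ?g0 ?addbT // => i; apply: necklace_alt.
pose h j := g (2 * j).
have hl j : h j < l by rewrite par mul2n odd_double.
have h_neq i d : 0 < d < k -> h i <> h (i + d) :> nat.
  move=> /andP[d0 ltd] /val_inj/g_inj/eqP.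
  rewrite mulnDr -[X in X == _ %[mod _]]addn0 eqn_modDl mod0n modn_small ?ltn_mul2l //.
  by rewrite eq_sym muln_eq0 /= gtn_eqF.
have next j : (h j.+1 == (h j).+1 %% l :> nat) || (h j == (h j.+1).+1 %% l :> nat).
  have od : odd (2 * j).+1 by rewrite mul2n /= odd_double.
  have a1 := adjg (2 * j); have a2 := adjg (2 * j).+1.
  have vl : (g (2 * j).+1 < l) = false by rewrite par od.
  have e2 : (2 * j).+2 = 2 * j.+1 by rewrite mulnS.
  rewrite e2 -/(h j.+1) in a2; rewrite -/(h j) in a1.
  move: a1 a2; rewrite /necklace /spoke !vl /= ?andbF ?orbF.
  move=> /and3P[_ _ a1] /and3P[_ _ a2].
  have ne : h j <> h j.+1 :> nat.
    by rewrite -[j.+1]addn1; apply: h_neq; move: k3; clear; lia.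
  move: (nat_of_ord (h j)) (nat_of_ord (h j.+1)) (nat_of_ord (g _)) ne a1 a2 => x y v ne.
  have mS : (v %% l).+1 %% l = v.+1 %% l by rewrite -addn1 modnDml addn1.
  case/orP=> /eqP ex; case/orP=> /eqP ey.
  - by case: ne; rewrite -ex -ey.
  - by rewrite -ex -ey mS eqxx.
  - by rewrite -ex -ey mS eqxx orbT.
  - by case: ne; rewrite -ex -ey.
have succ_inj x y : x < l -> y < l -> x.+1 %% l = y.+1 %% l -> x = y.
  move=> xl yl /eqP; rewrite -(addn1 x) -(addn1 y) eqn_modDr !modn_small //.
  by move/eqP.
have h2 j : h j <> h j.+2 :> nat.
  by rewrite -[j.+2]addn2; apply: h_neq; move: k3; clear; lia.
have hk : h k = h 0 by rewrite /h gk.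
have no_wrap : (h 0 + k) %% l <> h 0.
  move=> eq; have : h 0 + k = h 0 + 0 %[mod l] by rewrite eq addn0 modn_small.
  by move/eqP; rewrite eqn_modDl mod0n modn_small // => /eqP k0; rewrite k0 in k3.
case/orP: (next 0) => dir.
  have up j : h j.+1 = (h j).+1 %% l :> nat.
    elim: j => [|j IH]; first exact/eqP.
    case/orP: (next j.+1) => [/eqP //|/eqP]; rewrite IH => /(succ_inj _ _ (hl _) (hl _)).
    by move=> eq; case: (h2 j).
  apply: no_wrap; rewrite -[in RHS]hk.
  elim: (k) => [|j IH]; first by rewrite addn0 modn_small.
  by rewrite up -IH addnS -addn1 -modnDml addn1.
have down j : h j = (h j.+1).+1 %% l :> nat.
  elim: j => [|j IH]; first exact/eqP.
  case/orP: (next j.+1) => [/eqP|/eqP //]; rewrite -IH => eq.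
  by case: (h2 j).
apply: no_wrap; rewrite -{1}hk.
have : forall j, (h j + j) %% l = h 0.
  elim=> [|j IH]; first by rewrite addn0 modn_small.
  by rewrite addnS -addSn -modnDml -down.
exact.
Qed.

Lemma necklace_free l n k (f : {ffun 'I_(2 * k) -> 'I_n}) (k0 : 0 < 2 * k) :
  3 <= k < l -> injective f ->
  (forall j, necklace l (periodic k0 f j) (periodic k0 f j.+1)) -> False.
Proof.
move=> kl f_inj adjf; set g := periodic k0 f in adjf.
have g_inj i j : g i = g j -> i = j %[mod 2 * k] by exact: periodic_inj.
have per i : g (i + 2 * k) = g i by apply: eq_periodic; rewrite modnDr.
case: (boolP (g 0 < l)) => g0.
  by apply: (necklace_free_hub kl g_inj _ g0 adjf); rewrite -[2 * k]add0n per.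
(* When position 0 is no hub, position 1 is one, and the cycle is rotated by one. *)
apply: (necklace_free_hub (g := fun j => g j.+1) kl) => [i j /g_inj/eqP|||j] //.
- by rewrite -(addn1 i) -(addn1 j) eqn_modDr => /eqP.
- by rewrite -add1n per.
- by have := necklace_alt (adjf 0); rewrite (negPf g0) eq_sym eqbF_neg negbK.
Qed.

(** Each of the [l] gaps between consecutive hubs is filled by one of [q] vertices, and the edge set
    remembers the choices. *)
Lemma num_cycles_necklace l n q : 1 < l -> l * q.+1 <= n ->
  q ^ l <= num_cycles (2 * l) (graph_of (@necklace l n)).
Proof.
move=> l2 le_n; have l0 : 0 < l by exact: ltnW.
(* The successor on [c (half_ord i)] skips the block of hubs. *)
pose w (c : {ffun 'I_l -> 'I_q}) (i : 'I_(2 * l)) :=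
  if odd i then (c (half_ord i)).+1 * l + i./2 else i./2.
have w_lt c i : w c i < n.
  apply: leq_trans le_n; rewrite /w; have hi := ltn_half_double i; case: ifP => _.
    rewrite mulnS addnC [l * q]mulnC -addSn leq_add // leq_mul2r.
    by rewrite ltn_ord orbT.
  by rewrite mulnS ltn_addr.
pose F c : {ffun 'I_(2 * l) -> 'I_n} := [ffun i => Ordinal (w_lt c i)].
have F_inj c : injective (F c).
  move=> i j; rewrite !ffunE => /(congr1 val) /=; rewrite /w.
  have hi := ltn_half_double i; have hj := ltn_half_double j.
  case oi: (odd i); case oj: (odd j).
  - move/(congr1 (modn^~ l)); rewrite !modnMDl !modn_small // => eq_h.
    by apply: half_ord_eq; [rewrite oi oj | apply: val_inj].
  - by move=> eq_ij; move: hj; rewrite -eq_ij mulSn -addnA ltnNge leq_addr.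
  - by move=> eq_ij; move: hi; rewrite eq_ij mulSn -addnA ltnNge leq_addr.
  - by move=> eq_h; apply: half_ord_eq; [rewrite oi oj | apply: val_inj].
have F_adj c j : adj (graph_of (@necklace l n)) (periodic (double_gt0 l2) (F c) j)
                   (periodic (double_gt0 l2) (F c) j.+1).
  rewrite adj_graph_of; last exact: necklace_sym.
  rewrite /periodic !ffunE /necklace /= /w /=.
  set i := Ordinal (ltn_pmod j _); set i' := Ordinal (ltn_pmod j.+1 _).
  have eq_i' : j.+1 %% (2 * l) = (j %% (2 * l)).+1 %% (2 * l).
    by rewrite -[in RHS]addn1 modnDml addn1.
  have oi : odd (j.+1 %% (2 * l)) = ~~ odd (j %% (2 * l)) by rewrite !odd_mod_double.
  rewrite oi; have := ltn_half_double i; have := ltn_half_double i'.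
  rewrite /= eq_i'; move: (j %% (2 * l)) (ltn_pmod j (double_gt0 l2)) => t lt_t.
  case ot: (odd t) => /= hi' hi.
    have et : t.+1 = 2 * (t./2).+1 by rewrite mul2n doubleS -{1}(odd_double_half t) ot.
    apply/orP; right; rewrite /spoke hi' mulSn -addnA leq_addr /= addnA -mulSn.
    apply/orP; right; rewrite -addnS modnMDl et -muln_modr [(2 * _)./2](_ : _ = (t./2).+1 %% l) //.
    by rewrite mul2n doubleK.
  have lt_t1 : t.+1 < 2 * l.
    by rewrite ltn_neqAle lt_t andbT; apply: contraFneq ot => /(congr1 odd) /=; rewrite mul2n odd_double => /negbFE.
  apply/orP; left; rewrite /spoke hi mulSn -addnA leq_addr /= addnA -mulSn.
  rewrite modnMDl modn_small ?hi' //; apply/orP; left.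
  by rewrite modn_small //= uphalf_half ot.
have -> : q ^ l = #|[set: {ffun 'I_l -> 'I_q}]| by rewrite cardsT card_ffun !card_ord.
have E_inj : injective (fun c => cycle_edges (F c)).
  move=> c c' eqE; apply/ffunP => i.
  have lt : (2 * i).+1 < 2 * l by have := ltn_ord i; clear; lia.
  have od : odd (2 * i) = false by rewrite mul2n odd_double.
  (* The vertex chosen for gap [i] lies on both cycles. Being at least [l], it has an odd position
     in [F c'], and its residue identifies the gap. *)
  have : exists j : 'I_(2 * l), F c (Ordinal lt) = F c' j.
    have := edge_in (double_gt0 l2) (F c) (2 * i).
    rewrite eqE => /(cycle_edgesP (double_gt0 l2))[j /setP/(_ (F c (Ordinal lt)))].
    rewrite !inE -!(periodicE (double_gt0 l2)) /= eqxx orbT => /esym/orP[]/eqP ->.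
      by exists (Ordinal (ltn_pmod j (double_gt0 l2))).
    by exists (Ordinal (ltn_pmod j.+1 (double_gt0 l2))).
  case=> j; rewrite !ffunE => /(congr1 val); rewrite /= {1}/w /= od /= => eq_v.
  have hi : uphalf (2 * i) = i by rewrite mul2n uphalf_double.
  have ho : half_ord (Ordinal lt) = i by apply: val_inj.
  have hj := ltn_half_double j.
  move: eq_v; rewrite /w; case: ifP => oj eq_v; last first.
    by move: hj; rewrite -eq_v mulSn -addnA ltnNge leq_addr.
  rewrite hi ho in eq_v; have eh : half_ord j = i.
    by apply: val_inj; have := congr1 (modn^~ l) eq_v; rewrite !modnMDl !modn_small.
  move/eqP: eq_v; rewrite eh (_ : j./2 = i); last by rewrite -[in RHS]eh.
  by rewrite eqn_add2r eqn_mul2r gtn_eqF //= eqSS => /eqP/val_inj.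
rewrite -(card_imset _ E_inj); apply/subset_leq_card/subsetP => _ /imsetP[c _ ->].
by apply/(cycle_copiesP (double_gt0 l2)); exists (F c).
Qed.

Lemma ffact_ge d l : ((d - l) ^ l <= d ^_ l)%N.
Proof.
rewrite ffact_prod -[l in (_ ^ l)%N]card_ord -prod_nat_const; apply: leq_prod => i _.
by rewrite leq_sub2l // ltnW.
Qed.

(** * Asymptotics *)

Local Open Scope ring_scope.

Lemma nat_above (x : rat) : exists N : nat, x <= N%:R.
Proof.
by exists (Num.trunc x).+1; rewrite ltW // truncnS_gt.
Qed.

(** By convexity, the power lies below its chord on [0, 1]. *)
Lemma expr_1D_le (x : rat) m : 0 <= x <= 1 -> (1 + x) ^+ m <= 1 + (2 ^+ m - 1) * x.
Proof.
case/andP=> x0 x1; elim: m => [|m IH]; first by rewrite !expr0 subrr mul0r addr0.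
rewrite exprS [X in _ <= 1 + (X - 1) * _]exprS.
have p1 : 1 <= 2 ^+ m :> rat by rewrite exprn_ege1.
move: (2 ^+ m) ((1 + x) ^+ m) p1 IH => p q p1 IH.
have h1 : (1 + x) * q <= (1 + x) * (1 + (p - 1) * x) by rewrite ler_wpM2l // addr_ge0.
have h2 : (p - 1) * x * x <= (p - 1) * x * 1 by rewrite ler_wpM2l // mulr_ge0 // subr_ge0.
by lra.
Qed.

(** Bernoulli's inequality. *)
Lemma expr_1B_ge (x : rat) m : 0 <= x <= 1 -> 1 - m%:R * x <= (1 - x) ^+ m.
Proof.
case/andP=> x0 x1; elim: m => [|m IH]; first by rewrite expr0 mul0r subr0.
rewrite exprS -natr1.
have h1 : (1 - x) * (1 - m%:R * x) <= (1 - x) * (1 - x) ^+ m by rewrite ler_wpM2l // subr_ge0.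
have h2 : 0 <= m%:R * (x * x) by rewrite mulr_ge0 // mulr_ge0.
by move: ((1 - x) ^+ m) h1 => q h1; lra.
Qed.

Lemma ex_cycle_upper (k l : nat) : (3 <= l)%N -> (2 <= k)%N ->
  forall eps : rat, 0 < eps -> exists N : nat, forall n : nat, (N <= n)%N ->
    (ex_cycle n l k)%:R <=
      (1 + eps) * ((2 ^ (l - 2) * (k - 1) ^ l)%:R / (2 * l)%:R) * (n ^ l)%:R.
Proof.
move=> l3 k2 eps eps0; have l2 := ltnW l3.
set K := (k + fat_const k)%N; set D := ((4 * k).+1 * fat_const k * K)%N.
(* Then [M >= M0] gives [2^(l-1) * D / M <= eps / 2]. *)
have [M0 hM0] := nat_above (2 ^+ l.-1 * D%:R * 2 / eps).
set M := maxn (maxn 1 D) M0.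
have M1 : (0 < M)%N by rewrite !leq_max.
have leDM : (D <= M)%N by rewrite !leq_max leqnn orbT.
have leM0 : (M0 <= M)%N by rewrite leq_max leqnn orbT.
have [E eqE] : exists E, E = (l * (M ^ 2 * K * (M ^ 2 * K * K ^ l.-1)) * (2 * l))%N.
  by exists (l * (M ^ 2 * K * (M ^ 2 * K * K ^ l.-1)) * (2 * l))%N.
(* [E] depends on [M] but not on [n], so beyond [N1] the term [E * n ^ l.-1] is at most
   [eps * n ^ l]. *)
have [N1 hN1] := nat_above (E%:R / eps).
exists (maxn (maxn 1 (M ^ 2)) N1) => n; rewrite !geq_max => /andP[/andP[n1 nM] nN1].
have := ex_cycle_bound k2 l2 M1 nM n1 (erefl _) (erefl _); rewrite -/K -/D -eqE.
rewrite -(ler_nat rat) natrD !natrM !natrX natrD => bound.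
have Mpos : 0 < M%:R :> rat by rewrite ltr0n.
have npos : 0 < n%:R :> rat by rewrite ltr0n.
set y : rat := D%:R / M%:R.
have y0 : 0 <= y by rewrite divr_ge0.
have y1 : y <= 1 by rewrite ler_pdivrMr // mul1r ler_nat.
have eqMD : (M%:R + D%:R) ^+ l.-1 = M%:R ^+ l.-1 * (1 + y) ^+ l.-1 :> rat.
  by rewrite -exprMn /y mulrDr mulr1 mulrCA mulfV ?mulr1 ?gt_eqF.
have small : (1 + y) ^+ l.-1 <= 1 + eps / 2.
  apply: le_trans (expr_1D_le _ _) _; first by rewrite y0.
  rewrite lerD2l; apply: (@le_trans _ _ (2 ^+ l.-1 * y)).
    by rewrite ler_wpM2r // lerBlDr lerDl.
  have : 2 ^+ l.-1 * D%:R * 2 / eps <= M%:R by apply: le_trans hM0 _; rewrite ler_nat.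
  by rewrite ler_pdivrMr // /y mulrA ler_pdivrMr //; lra.
have c1 : 1 <= k.-1%:R ^+ l :> rat by rewrite exprn_ege1 // ler1n; clear -k2; lia.
have tail : E%:R * n%:R ^+ l.-1 <= eps * (k.-1%:R ^+ l * n%:R ^+ l).
  apply: (@le_trans _ _ (eps * n%:R * n%:R ^+ l.-1)).
    rewrite ler_wpM2r ?exprn_ge0 //.
    have : E%:R / eps <= n%:R by apply: le_trans hN1 _; rewrite ler_nat.
    by rewrite ler_pdivrMr // mulrC.
  rewrite -mulrA -exprS prednK ?(ltnW l2) // ler_wpM2l ?(ltW eps0) //.
  by rewrite ler_peMl ?exprn_ge0.
have p2 : 2 <= 2 ^+ (l - 2) :> rat.
  by rewrite -{1}(expr1 2) ler_weXn2l ?ler1n // subn_gt0.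
have le : (ex_cycle n l k)%:R * (2%:R * l%:R) <=
    (1 + eps) * (2 ^+ (l - 2) * k.-1%:R ^+ l) * n%:R ^+ l :> rat.
  apply: (@le_trans _ _ (2 * k.-1%:R ^+ l * n%:R ^+ l * (1 + y) ^+ l.-1 + E%:R * n%:R ^+ l.-1)).
    rewrite -(ler_pM2l (exprn_gt0 l.-1 Mpos)); apply: le_trans bound _.
    rewrite eqMD le_eqVlt; apply/orP; left; apply/eqP.
    by move: (M%:R ^+ l.-1) ((1 + y) ^+ l.-1) (n%:R ^+ l.-1) => p q r; ring.
  have cn0 : 0 <= k.-1%:R ^+ l * n%:R ^+ l :> rat by rewrite mulr_ge0 ?exprn_ge0.
  have h1 := ler_wpM2l cn0 small.
  (* The main term gives [2 (1 + eps/2)] and the tail [eps], together [2 (1 + eps)]; this is where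
     [2 <= 2^(l-2)] enters. *)
  have h2 : 0 <= (2 ^+ (l - 2) - 2) * ((1 + eps) * (k.-1%:R ^+ l * n%:R ^+ l)) :> rat.
    by rewrite mulr_ge0 ?subr_ge0 // mulr_ge0 // addr_ge0 // ltW.
  move: h1 h2 tail; move: ((1 + y) ^+ l.-1) (E%:R * _) (2 ^+ (l - 2)) => q t p.
  by rewrite -!mulrA; move: (k.-1%:R ^+ l) (n%:R ^+ l) => c m h1 h2 tail; lra.
have l0 : 0 < 2%:R * l%:R :> rat by rewrite mulr_gt0 // ltr0n ltnW.
by rewrite subn1 mulrA mulrAC ler_pdivlMr.
Qed.

(** Bernoulli's inequality at [a / n]: it suffices that [n > a] and [n >= l a / eps]. *)
Lemma expn_subn_ge (a l : nat) (eps : rat) : 0 < eps ->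
  exists N : nat, forall n : nat, (N <= n)%N -> (1 - eps) * (n ^ l)%:R <= ((n - a) ^ l)%:R.
Proof.
move=> eps0; have [N hN] := nat_above (l%:R * a%:R / eps).
exists (maxn N a.+1) => n; rewrite geq_max => /andP[leN lta].
have n0 : 0 < n%:R :> rat by rewrite ltr0n; lia.
have -> : ((n - a) ^ l)%:R = (1 - a%:R / n%:R) ^+ l * (n ^ l)%:R :> rat.
  by rewrite !natrX -exprMn mulrBl mul1r divfK ?gt_eqF // natrB // ltnW.
rewrite ler_wpM2r //; apply: le_trans (expr_1B_ge _ _); last first.
  by rewrite divr_ge0 //= ler_pdivrMr // mul1r ler_nat ltnW.
rewrite lerD2l lerN2 mulrA ler_pdivrMr //.
have : l%:R * a%:R / eps <= n%:R by apply: le_trans hN _; rewrite ler_nat.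
by rewrite ler_pdivrMr // [n%:R * _]mulrC.
Qed.

Lemma ex_cycle_lower_small (k l : nat) : (2 <= l)%N -> (l < k)%N ->
  forall eps : rat, 0 < eps -> exists N : nat, forall n : nat, (N <= n)%N ->
    (1 - eps) * (((k - 1) ^_ l)%:R / (2 * l)%:R) * (n ^ l)%:R <= (ex_cycle n l k)%:R.
Proof.
(* The loss [k - 1] is the small class, and [l] pays for the falling factorial. *)
move=> l2 lt_lk eps eps0; have [N hN] := expn_subn_ge (k - 1 + l) l eps0.
exists (maxn N (k - 1)) => n; rewrite geq_max => /andP[leN lek].
have low : ((k - 1) ^_ l * (n - (k - 1)) ^_ l <= ex_cycle n l k * (2 * l))%N.
  have := num_cycles_bip (k - 1) (n - (k - 1)) l2; rewrite subnKC // => h.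
  apply: leq_trans h _; rewrite leq_mul2r; apply/orP; right.
  apply: ex_cycle_ge => [||f k0|]; [exact: bip_sym|exact: bip_irr| |by lia].
  by apply: bip_free; lia.
have l0 : 0 < (2 * l)%:R :> rat by rewrite ltr0n; lia.
rewrite mulrA mulrAC ler_pdivrMr // -natrM.
apply: le_trans (_ : ((k - 1) ^_ l * (n - (k - 1 + l)) ^ l)%:R <= _); last first.
  by rewrite ler_nat (leq_trans _ low) // leq_mul2l subnDA ffact_ge orbT.
by rewrite natrM mulrAC mulrC ler_wpM2l // hN.
Qed.

Lemma ex_cycle_lower_large (k l : nat) : (3 <= k)%N -> (k < l)%N ->
  forall eps : rat, 0 < eps -> exists N : nat, forall n : nat, (N <= n)%N ->
    (1 - eps) * (1 / (l ^ l)%:R) * (n ^ l)%:R <= (ex_cycle n l k)%:R.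
Proof.
(* The hubs and rounding [n] down to a multiple of [l] cost at most [l] vertices each. *)
move=> k3 lt_kl eps eps0; have [N hN] := expn_subn_ge (l * 2) l eps0.
exists (maxn N l) => n; rewrite geq_max => /andP[leN len].
have l0 : (0 < l)%N by lia.
set q := (n %/ l).-1.
have eq_q : q.+1 = (n %/ l)%N by rewrite prednK // divn_gt0.
have low : (q ^ l <= ex_cycle n l k)%N.
  apply: leq_trans (_ : (num_cycles (2 * l) (graph_of (@necklace l n)) <= _)%N).
    by apply: num_cycles_necklace; rewrite ?eq_q 1?mulnC ?leq_divM //; lia.
  apply: ex_cycle_ge => [||f k0|]; [exact: necklace_sym|exact: necklace_irr| |by lia].
  by apply: necklace_free; rewrite k3.
have lq : (n - l * 2 <= l * q)%N.
  have := ltn_ceil n l0; rewrite -eq_q leq_subLR => h; apply: ltnW; apply: leq_trans h _.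
  by rewrite mulnC -mulnDr; apply: eq_leq; congr muln; lia.
have ll0 : 0 < (l ^ l)%:R :> rat by rewrite ltr0n expn_gt0 l0.
rewrite mul1r mulrAC ler_pdivrMr // -natrM; apply: le_trans (hN n leN) _.
rewrite ler_nat [leqRHS]mulnC; apply: leq_trans (_ : ((l * q) ^ l <= _)%N).
  by rewrite leq_exp2r.
by rewrite expnMn leq_mul2l low orbT.
Qed.

Theorem theorem8 (k l : nat) :
  ((3 <= l)%N -> (2 <= k)%N ->
    forall eps : rat, 0 < eps -> exists N : nat, forall n : nat, (N <= n)%N ->
      (ex_cycle n l k)%:R <=
        (1 + eps) * ((2 ^ (l - 2) * (k - 1) ^ l)%:R / (2 * l)%:R) * (n ^ l)%:R)
  /\
  ((2 <= l)%N -> (l < k)%N ->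
    forall eps : rat, 0 < eps -> exists N : nat, forall n : nat, (N <= n)%N ->
      (1 - eps) * (((k - 1) ^_ l)%:R / (2 * l)%:R) * (n ^ l)%:R
        <= (ex_cycle n l k)%:R)
  /\
  ((3 <= k)%N -> (k < l)%N ->
    forall eps : rat, 0 < eps -> exists N : nat, forall n : nat, (N <= n)%N ->
      (1 - eps) * (1 / (l ^ l)%:R) * (n ^ l)%:R <= (ex_cycle n l k)%:R).
Proof.
split; first exact: ex_cycle_upper.
split; [exact: ex_cycle_lower_small | exact: ex_cycle_lower_large].
Qed.
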